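(* For the urn model $R$ with parameters $m,c$ and initial composition $(W_0,B_0)$ described in the context, the random variable $\mathcal{W}_n=W_n/T_n$ is a positive martingale with respect to the natural filtration $(\mathcal{F}_n)_{n\ge 0}$, i.e. $\mathbb{E}(\mathcal{W}_n\mid\mathcal{F}_{n-1})=\mathcal{W}_{n-1}$ for $n\ge 1$. Consequently, $\mathcal{W}_n$ converges almost surely to a random variable $\mathcal{W}_\infty$. Furthermore, for fixed $W_0$, $B_0$, $c$ and $m$, (the distribution of) $\mathcal{W}_\infty$ is absolutely continuous (with respect to Lebesgue measure).
   Context: Urn model $R$: let $m\ge 1$ and $c\ge 1$ be integers. An urn initially contains $W_0$ white and $B_0$ black balls, where $W_0,B_0$ are integers with $W_0>0$, $B_0>0$, and $T_0=W_0+B_0\ge m$. At each discrete time step $m$ balls are drawn one by one uniformly at random with replacement from the urn (each drawn ball is put back after observing its color, before the next is drawn). If $m-\ell$ white balls and $\ell$ black balls have been observed ($0\le\ell\le m$), then $c(m-\ell)$ white balls and $c\ell$ black balls are added to the urn. $W_n$ and $B_n$ denote the numbers of white and black balls after $n$ draws (time steps); the total is $T_n=W_n+B_n=T_0+nmc$. $\mathcal{F}_n$ is the $\sigma$-field generated by the first $n$ draws. Thus, given $\mathcal{F}_{n-1}$, the probability that the $n$-th sample has exactly $k$ white balls is $\binom{m}{k}W_{n-1}^k(T_{n-1}-W_{n-1})^{m-k}/T_{n-1}^m$, $0\le k\le m$, and then $W_n=W_{n-1}+kc$. *)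

(* Defs.v *)
From HB Require Import structures.
From mathcomp Require Import all_boot all_order all_algebra.
From mathcomp Require Import all_classical all_reals all_analysis.

Set Implicit Arguments.
Unset Strict Implicit.
Unset Printing Implicit Defensive.

Import Order.TTheory GRing.Theory Num.Theory.
Import numFieldNormedType.Exports.

Local Open Scope classical_set_scope.
Local Open Scope ring_scope.

Section conditioning.
Context d (T : measurableType d) (R : realType) (P : probability T R).

(* Y is a version of the conditional expectation E(X | G). *)
Definition is_cond_expectation (G : set_system T) (X Y : T -> R) : Prop :=
  [/\ P.-integrable setT (EFin \o X),
      P.-integrable setT (EFin \o Y),
      preimage_set_system setT Y measurable `<=` G &
      forall A, G A ->
        (\int[P]_(w in A) (Y w)%:E = \int[P]_(w in A) (X w)%:E)%E].

Definition is_cond_probability (G : set_system T) (A : set T) (Y : T -> R) :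
  Prop := is_cond_expectation G \1_A Y.

Definition is_filtration (F : nat -> set_system T) : Prop :=
  [/\ forall n, sigma_algebra setT (F n),
      forall n, F n `<=` measurable &
      forall n, F n `<=` F n.+1].

Definition is_martingale (F : nat -> set_system T) (M : nat -> T -> R) :
  Prop :=
  [/\ is_filtration F,
      forall n, preimage_set_system setT (M n) measurable `<=` F n,
      forall n, P.-integrable setT (EFin \o M n) &
      forall n, is_cond_expectation (F n) (M n.+1) (M n)].

End conditioning.

(* [draw n i w] is true iff the i-th of the m balls drawn at time step n.+1
   is white; [white n], [black n] and [total n] describe the urn after n time
   steps. *)
Section urn.
Context d (T : measurableType d) (R : realType) (P : probability T R).
Variables (m c W0 B0 : nat) (draw : nat -> 'I_m -> T -> bool).

Fixpoint white (n : nat) (w : T) : nat :=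
  if n is k.+1 then (white k w + c * #|[set i | draw k i w]%SET|)%N else W0.

Fixpoint black (n : nat) (w : T) : nat :=
  if n is k.+1 then (black k w + c * #|[set i | ~~ draw k i w]%SET|)%N else B0.

Definition total (n : nat) (w : T) : nat := (white n w + black n w)%N.

Lemma totalE n w : total n w = (W0 + B0 + n * m * c)%N.
Proof.
elim: n => [|n IHn]; first by rewrite /total /= !mul0n addn0.
rewrite /total /= addnACA -/(total n w) IHn -mulnDr.
rewrite [X in (_ + c * X)%N](_ : _ = m); last first.
  have -> : [set i | ~~ draw n i w]%SET = (~: [set i | draw n i w])%SET.
    by apply/setP => i; rewrite !inE.
  by rewrite cardsC card_ord.
by rewrite mulSn mulnDl -addnA [(c * m)%N]mulnC [(n * m * c + _)%N]addnC.
Qed.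

Definition draw_filtration (n : nat) : set_system T :=
  <<s \bigcup_(k in `I_n) \bigcup_(i in [set: 'I_m])
        preimage_set_system setT (draw k i) measurable >>.

Definition white_fraction (n : nat) (w : T) : R :=
  (white n w)%:R / (total n w)%:R.

Definition black_fraction (n : nat) (w : T) : R :=
  (black n w)%:R / (total n w)%:R.

(* The m drawings of one time step are uniform and with replacement: given the
   previous time steps, each ball is independently white with probability
   W_n / T_n.  Summing over the 'C(m, k) colour patterns [s] with k white balls
   gives probability 'C(m, k) W_n^k B_n^(m-k) / T_n^m of k white balls. *)
Definition drawn_with_replacement : Prop :=
  forall (n : nat) (s : 'I_m -> bool),
    is_cond_probability P (draw_filtration n)
      [set w | forall i, draw n i w = s i]
      (fun w => \prod_(i < m)
         (if s i then white_fraction n w else black_fraction n w)).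

End urn.

(* Main.v *)
(* Let N_n be the number of white draws in the first n steps, X_n the proportion
   of white balls, T_n the size of the urn.

   Convergence: |X_{n+1} - X_n| <= 1 / (n + 1), so E (X_b - X_a)^2 is at most the
   sum of 1 / (j + 1)^2 over a <= j < b.  Along the cubes k^3 this is O(k^-4), so
   the increments of X_{k^3} are almost surely absolutely summable, and between
   two cubes X moves by only O(1 / k).  No maximal inequality is needed.

   Absolute continuity: if all P(N_n = i) are at most M, then P(N_{n+1} = j) is at
   most M times the sum over k of C(m, k) (y - k d)^k (1 - y + k d)^(m - k), where
   d = c / T_n and y is the proportion attached to j.  By an Abel identity this sum
   does not depend on y, and its value at y = 0 is 1 - m d + O(d^2).  Since
   T_{n+1} = T_n (1 + m d) and the d^2 are summable, T_n max_i P(N_n = i) stays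
   bounded.  The identity counts terms whose factors y - k d or 1 - y + k d may be
   negative; these are O(d^2) once each colour has been drawn, so the estimate is
   made on the event that this has happened by time l.  On that event the limit
   gives an interval of length h mass O(h), hence gives mass 0 to null sets, and
   the probability of the event tends to 1 as l grows. *)
Require Import Defs.
From HB Require Import structures.
From mathcomp Require Import all_boot all_order all_algebra.
From mathcomp Require Import all_classical all_reals all_analysis.
From mathcomp Require Import measurable_realfun.
From mathcomp Require Import ring lra zify.

Set Implicit Arguments.
Unset Strict Implicit.
Unset Printing Implicit Defensive.

Import Order.TTheory GRing.Theory Num.Theory.
Import numFieldNormedType.Exports.

Local Open Scope classical_set_scope.
Local Open Scope ring_scope.

(** * Abel sums *)

Section abel.
Context {R : realFieldType}.

(** For [z = - d] and [0 <= x - k d <= 1] this is the chance of [k] white balls in a sample from an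
    urn of white proportion [x - k d]. The base moves with [k], so the sum over [k] is of Abel type
    and not binomial. *)
Definition abel_term (z : R) n k (x : R) : R :=
  (x + z *+ k) ^+ k * (1 - x - z *+ k) ^+ (n - k) *+ 'C(n, k).

Lemma polyC_of_deriv0 (p : {poly R}) : p^`() = 0 -> p = (p`_0)%:P.
Proof.
move=> p'0; apply/polyP => -[|i]; rewrite coefC//=.
have /eqP : (p^`())`_i = 0 by rewrite p'0 coef0.
by rewrite coef_deriv mulrn_eq0/= => /eqP.
Qed.

Lemma comp_polyMn (p q : {poly R}) n : (p *+ n) \Po q = (p \Po q) *+ n.
Proof. by elim: n => [|n IHn]; rewrite ?comp_poly0// !mulrS comp_polyD IHn. Qed.

Lemma comp_polyXn (p q : {poly R}) n : (p ^+ n) \Po q = (p \Po q) ^+ n.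
Proof.
by elim: n => [|n IHn]; rewrite ?comp_polyC// !exprS comp_polyM IHn.
Qed.

(* With [S_n] the sum below, the derivative of [S_n.+1] at [x] is
   [(n + 1) (S_n (x + z) - S_n x)], which vanishes by induction. *)
Lemma abel_poly_const (z : R) n : exists a : R,
  \sum_(k < n.+1) ('X + (z *+ k)%:P) ^+ k * (1 - 'X - (z *+ k)%:P) ^+ (n - k)
    *+ 'C(n, k) = a%:P :> {poly R}.
Proof.
elim: n => [|n [a IHn]].
  by exists 1; rewrite big_ord_recl big_ord0 /= !expr0 mulr1 addr0.
set P := (X in X = _) in IHn; set Q := (X in exists a, X = _).
suff Q'0 : Q^`() = 0 by exists Q`_0; exact: polyC_of_deriv0.
have -> : Q^`() = (P \Po ('X + z%:P) - P) *+ n.+1.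
  have dA (b : R) : ('X + b%:P)^`() = 1 by rewrite derivD derivC derivX addr0.
  have dB (b : R) : (1 - 'X - b%:P)^`() = -1.
    by rewrite !derivB -polyC1 !derivC derivX sub0r subr0.
  rewrite /Q raddf_sum/=.
  under eq_bigr => k _.
    rewrite derivMn derivM !deriv_exp dA dB mulN1r mul1r mulNrn mulrN mulrnBl.
    over.
  (* Derivatives of the first factors: index 0 drops out, and [(k + 1) C(n + 1, k + 1) = (n + 1)
     C(n, k)] leaves the previous sum at [x + z]. *)
  rewrite sumrB mulrnBl; congr (_ - _).
    rewrite big_ord_recl/= mulr0n mul0r mul0rn add0r /P raddf_sum/= -sumrMnl.
    apply: eq_bigr => k _.
    rewrite comp_polyMn comp_polyM !comp_polyXn !comp_polyB !comp_polyD.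
    rewrite -[1]polyC1 !comp_polyX !comp_polyC /bump/= add1n subSS mulrnAl -!mulrnA.
    rewrite [('C(n, k) * _)%N]mulnC mul_bin_diag.
    congr (_ ^+ _ * _ ^+ _ *+ _).
    - by rewrite mulrS polyCD addrA.
    - by rewrite mulrS polyCD !opprD !addrA.
  (* Derivatives of the second factors: the last index drops out, and [(n + 1 - k) C(n + 1, k) = (n
     + 1) C(n, k)] leaves the previous sum at [x]. *)
  rewrite big_ord_recr/= subnn mulr0n mulr0 mul0rn addr0 /P -sumrMnl.
  apply: eq_bigr => k _.
  have kn : (k <= n)%N by rewrite -ltnS.
  rewrite mulrnAr -!mulrnA [in LHS](subSn kn) -pred_Sn; congr (_ *+ _).
  by rewrite [RHS]mulnC (mul_bin_down n.+1) subSn.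
by rewrite IHn comp_polyC subrr mul0rn.
Qed.

Lemma abel_sum_const (z : R) n x y :
  \sum_(k < n.+1) abel_term z n k x = \sum_(k < n.+1) abel_term z n k y.
Proof.
have [a Pa] := abel_poly_const z n.
suff H u : \sum_(k < n.+1) abel_term z n k u = a by rewrite !H.
rewrite -[RHS](hornerC a u) -Pa horner_sum; apply: eq_bigr => k _.
by rewrite hornerMn hornerM !horner_exp !hornerE.
Qed.

(** Since [d <= 1] and [i >= 2], [d ^ i] is at most [d ^ 2]; all remaining factors are absorbed in
    powers of [M]. *)
Lemma expr_quad_bound (M d a b : R) i j : 0 <= d <= 1 -> 1 <= M ->
  (2 <= i)%N -> `|a| <= M * d -> `|b| <= M ->
  `|a ^+ i * b ^+ j| <= M ^+ (i + j) * d ^+ 2.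
Proof.
move=> /andP[d0 d1] M1 i2 aM bM.
have M0 : 0 <= M by rewrite (le_trans _ M1).
rewrite normrM !normrX exprD mulrAC; apply: ler_pM; rewrite ?exprn_ge0//; last first.
  by rewrite lerXn2r// nnegrE.
rewrite (@le_trans _ _ ((M * d) ^+ i)) ?lerXn2r ?nnegrE ?mulr_ge0//.
by rewrite exprMn ler_wpM2l ?exprn_ge0// ler_wiXn2l.
Qed.

(* Terms with [y - k d] outside [0, 1] are of order [d ^ 2]: the hypotheses on
   [y] force the exponent of the negative factor to be at least 2. *)
Lemma abel_kernel_bound m : exists2 C : R, 0 <= C &
  forall d y : R, 0 <= d <= 1 -> d <= y -> y <= 1 + d *+ m - d ->
  \sum_(k < m.+1 | 0 <= y - d *+ k <= 1)
     (y - d *+ k) ^+ k * (1 - (y - d *+ k)) ^+ (m - k) *+ 'C(m, k)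
  <= 1 - d *+ m + C * d ^+ 2.
Proof.
pose M : R := 1 + m%:R.
have M1 : 1 <= M by rewrite lerDl.
have M0 : 0 <= M by rewrite (le_trans _ M1).
pose C := \sum_(k < m.+1) M ^+ m *+ 'C(m, k).
have C0 : 0 <= C by apply: sumr_ge0 => k _; rewrite mulrn_wge0// exprn_ge0.
(* One [C] pays for the terms of index at least 2 in the full sum, the other for the terms excluded
   by the condition on [y - d *+ k]. *)
exists (C + C); first exact: addr_ge0.
move=> d y d01 dy yd; have /andP[d0 d1] := d01.
have termE k x : (x - d *+ k) ^+ k * (1 - (x - d *+ k)) ^+ (m - k) *+ 'C(m, k)
    = abel_term (- d) m k x.
  by rewrite /abel_term mulNrn opprD addrA.
under eq_bigr do rewrite termE.
have dk (k : 'I_m.+1) : d *+ k <= m%:R * d.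
  by rewrite mulr_natl ler_wpMn2l// -ltnS.
have low k x : (k <= m)%N -> (2 <= k)%N -> `|x - d *+ k| <= M * d ->
    `|1 - (x - d *+ k)| <= M -> `|abel_term (- d) m k x| <= d ^+ 2 * (M ^+ m *+ 'C(m, k)).
  move=> km k2 a1 a2; rewrite -termE normrMn mulrnAr lerMn2r; apply/orP; right.
  rewrite [leRHS]mulrC; have := @expr_quad_bound _ _ _ _ k (m - k) d01 M1 k2 a1 a2.
  by rewrite subnKC.
have up k x : (k <= m)%N -> (2 <= m - k)%N -> `|1 - (x - d *+ k)| <= M * d ->
    `|x - d *+ k| <= M -> `|abel_term (- d) m k x| <= d ^+ 2 * (M ^+ m *+ 'C(m, k)).
  move=> km k2 a1 a2; rewrite -termE normrMn mulrnAr lerMn2r; apply/orP; right.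
  rewrite [leRHS]mulrC; have := @expr_quad_bound _ _ _ _ (m - k) k d01 M1 k2 a1 a2.
  rewrite subnK// [X in `|X|]mulrC; exact.
have dm1 : d *+ m <= m%:R by rewrite -[leRHS]mulr_natl mulr1 -[leLHS]mulr_natl ler_piMr.
have all_le : \sum_(k < m.+1) abel_term (- d) m k y <= 1 - d *+ m + C * d ^+ 2.
  (* The full sum is moved to [y = 0]: index 0 gives 1, index 1 gives
     [- m d (1 + d)^(m - 1) <= - m d], and the later terms are [O(d^2)]. *)
  rewrite (abel_sum_const _ _ _ 0) /C mulr_suml.
  apply: (@le_trans _ _ (\sum_(k < m.+1) ((k == 0 :> nat)%:R
    - (d *+ m) *+ (k == 1 :> nat) + M ^+ m *+ 'C(m, k) * d ^+ 2))).
    apply: ler_sum => -[[|[|k]] km] _ /=.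
    - have -> : abel_term (- d) m 0 0 = 1.
        by rewrite /abel_term !mulr0n expr0 !subr0 expr1n mul1r bin0.
      by rewrite mulr0n subr0 mulr1n lerDl mulr_ge0 ?mulrn_wge0 ?exprn_ge0.
    - rewrite /abel_term/= mulr1n add0r expr1 subr0 opprK bin1 add0r mulNr mulNrn.
      rewrite (@le_trans _ _ (- (d *+ m)))//.
        rewrite lerN2 -mulrnAl ler_peMr ?mulrn_wge0//.
        by rewrite exprn_ege1// lerDl.
      by rewrite lerDl mulr_ge0 ?mulrn_wge0 ?exprn_ge0.
    rewrite subr0 add0r mulrC (le_trans (ler_norm _))//.
    have kd := dk (Ordinal km); rewrite /= in kd.
    have kd0 : 0 <= d *+ k.+2 by exact: mulrn_wge0.
    apply: low => //; rewrite sub0r; move: (d *+ k.+2) kd kd0 => e kd kd0;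
      rewrite ?opprK ?normrN ger0_norm ?addr_ge0//.
      by rewrite (le_trans kd)// ler_wpM2r// lerDr.
    by rewrite lerD2l (le_trans kd)// ler_piMr.
  rewrite big_split/= lerD2r sumrB lerB//.
    by rewrite big_ord_recl/= big1 ?addr0.
  have [->|m0] := posnP m; first by rewrite mulr0n sumr_ge0// => k; rewrite mul0rn.
  rewrite (bigD1 (Ordinal (m0 : (1 < m.+1)%N)))//= mulr1n lerDl.
  by apply: sumr_ge0 => k _; rewrite !mulrn_wge0.
rewrite mulrDl addrA (le_trans _ (lerD all_le (lexx _)))//.
rewrite [X in _ <= X + _](bigID (fun k : 'I_m.+1 => 0 <= y - d *+ k <= 1))/=.
rewrite -addrA lerDl -lerBlDr sub0r lerNl -sumrN /C mulr_suml.
rewrite [leRHS](bigID (fun k : 'I_m.+1 => 0 <= y - d *+ k <= 1))/=.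
rewrite ler_wpDl//.
  by apply: sumr_ge0 => k _; rewrite mulr_ge0 ?mulrn_wge0 ?exprn_ge0.
apply: ler_sum => k out; rewrite [leRHS]mulrC (le_trans (ler_norm _))// normrN.
have km : (k <= m)%N by rewrite -ltnS.
have kd0 : 0 <= d *+ k by rewrite mulrn_wge0.
have kdm := dk k.
have y0 : 0 <= y by rewrite (le_trans d0).
have dmd : d *+ m = m%:R * d by rewrite mulr_natl.
have Md : m%:R * d <= M * d by rewrite ler_wpM2r// lerDr.
have md1 : m%:R * d <= m%:R by rewrite ler_piMr.
move: out; rewrite negb_and -!ltNge => /orP[neg|big].
- apply: low => //.
  + rewrite ltnNge; apply/negP => k1; move: neg; rewrite ltNge => /negP; apply.
    rewrite subr_ge0 (le_trans _ dy)// -[leRHS]mulr1n ler_wpMn2l//.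
  + rewrite ltr0_norm//; lra.
  + rewrite ger0_norm /M; lra.
- apply: up => //.
  + rewrite ltnNge; apply/negP => k1.
    have : d *+ (m - k) <= d by rewrite -[leRHS]mulr1n ler_wpMn2l.
    by rewrite mulrnBr//; lra.
  + rewrite ltr0_norm; lra.
  + rewrite ger0_norm /M; lra.
Qed.
End abel.

(** * Finitely valued random variables *)

Section finitely_valued.
Context d (T : measurableType d) (R : realType) (P : probability T R).

Definition Pr (A : set T) : R := fine (P A).

Lemma EFin_Pr A : measurable A -> (Pr A)%:E = P A.
Proof. by move=> mA; rewrite /Pr fineK ?fin_num_measure. Qed.

Lemma Pr_ge0 A : 0 <= Pr A.
Proof. exact: fine_ge0. Qed.

Lemma Pr_le A B : measurable A -> measurable B -> A `<=` B -> Pr A <= Pr B.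
Proof.
by move=> mA mB AB; rewrite -lee_fin !EFin_Pr// le_measure ?inE.
Qed.

Lemma Pr_le1 A : measurable A -> Pr A <= 1.
Proof. by move=> mA; rewrite -lee_fin EFin_Pr// probability_le1. Qed.

Lemma PrU_le A B : measurable A -> measurable B -> Pr (A `|` B) <= Pr A + Pr B.
Proof.
move=> mA mB; rewrite -lee_fin EFinD !EFin_Pr//; last exact: measurableU.
exact: measureU2.
Qed.

Lemma integral_indic_Pr A B : measurable A -> measurable B ->
  (\int[P]_(w in A) (\1_B w)%:E = (Pr (A `&` B))%:E)%E.
Proof.
move=> mA mB; rewrite integral_indic// EFin_Pr; last exact: measurableI.
by rewrite setIC.
Qed.

Lemma integral_cst_Pr A r : measurable A ->
  (\int[P]_(w in A) r%:E = (r * Pr A)%:E)%E.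
Proof. by move=> mA; rewrite integral_cst// EFinM EFin_Pr. Qed.

Section finite_codomain.
Context (I : finType) (Z : T -> I).
Hypothesis mZ : forall i, measurable (Z @^-1` [set i]).

Let comp_indic (g : I -> R) (w : T) : (g (Z w))%:E =
  (\sum_(i : I) ((g i)%:E * (\1_(Z @^-1` [set i]) w)%:E))%E.
Proof.
rewrite (bigD1 (Z w))//= big1 ?adde0.
  by rewrite indicE mem_set//= mule1.
move=> i iZ; rewrite indicE memNset ?mule0// => /= Zi.
by rewrite Zi eqxx in iZ.
Qed.

Lemma integrable_finitely_valued (g : I -> R) A : measurable A ->
  P.-integrable A (fun w => (g (Z w))%:E).
Proof.
move=> mA; apply: (@integrableS _ _ _ _ setT) => //.
under [X in integrable _ _ X]funext do rewrite comp_indic.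
apply: integrable_sum => // i _; apply: integrableZl => //.
exact: integrable_indic.
Qed.

Lemma integral_finitely_valued (g : I -> R) A : measurable A ->
  (\int[P]_(w in A) (g (Z w))%:E =
   (\sum_(i : I) g i * Pr (A `&` Z @^-1` [set i]))%:E)%E.
Proof.
move=> mA; under eq_integral do rewrite comp_indic.
have iI i : P.-integrable A (fun w => (\1_(Z @^-1` [set i]) w)%:E).
  by apply: (@integrableS _ _ _ _ setT) => //; exact: integrable_indic.
rewrite integral_sum//; last by move=> i; exact: integrableZl.
rewrite -sumEFin; apply: eq_bigr => i _.
by rewrite integralZl// integral_indic_Pr.
Qed.

End finite_codomain.
End finitely_valued.

(** * The law of one step of the urn *)

Section urn_process.
Context d (T : measurableType d) (R : realType) (P : probability T R).
Context (m c W0 B0 : nat) (draw : nat -> 'I_m -> T -> bool).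

Definition pattern n w : {set 'I_m} := [set i | draw n i w]%SET.

Definition nwhite n w : nat := \sum_(k < n) #|pattern k w|.

Definition urn_size n : R := (W0 + B0 + n * m * c)%:R.

(** The white proportion at time [n] depends on the past only through the number [i] of white draws,
    so the urn is studied as a Markov chain on integers. *)
Definition frac n i : R := (W0 + c * i)%:R / urn_size n.

Lemma nwhiteS n w : nwhite n.+1 w = (nwhite n w + #|pattern n w|)%N.
Proof. by rewrite /nwhite big_ord_recr. Qed.

Lemma nwhite_le n w : (nwhite n w <= n * m)%N.
Proof.
elim: n => [|n IHn]; first by rewrite /nwhite big_ord0.
rewrite nwhiteS mulSn addnC leq_add//.
by rewrite -[leqRHS]card_ord max_card.
Qed.

Lemma whiteE n w : white c W0 draw n w = (W0 + c * nwhite n w)%N.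
Proof.
elim: n => [|n IHn] /=; first by rewrite /nwhite big_ord0 muln0 addn0.
by rewrite nwhiteS IHn mulnDr addnA.
Qed.

Lemma white_fractionE n w :
  white_fraction R c W0 B0 draw n w = frac n (nwhite n w).
Proof. by rewrite /white_fraction whiteE totalE. Qed.

Hypothesis W0_gt0 : (0 < W0)%N.

Lemma urn_size_gt0 n : 0 < urn_size n.
Proof. by rewrite ltr0n -addnA addn_gt0 W0_gt0. Qed.

Lemma black_fractionE n w :
  black_fraction R c W0 B0 draw n w = 1 - frac n (nwhite n w).
Proof.
apply/eqP; rewrite eq_sym subr_eq -white_fractionE; apply/eqP.
rewrite /black_fraction /white_fraction -mulrDl -natrD addnC divff//.
by rewrite -[(_ + _)%N]/(Defs.total c W0 B0 draw n w) totalE gt_eqF ?urn_size_gt0.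
Qed.

Lemma frac_ge0 n i : 0 <= frac n i.
Proof. by rewrite divr_ge0 ?ler0n. Qed.

Lemma frac_le1 n i : (i <= n * m)%N -> frac n i <= 1.
Proof.
move=> inm; rewrite ler_pdivrMr ?urn_size_gt0// mul1r ler_nat.
by rewrite leq_add ?leq_addr// mulnC leq_mul.
Qed.

Hypothesis mdraw : forall n i, measurable_fun setT (draw n i).

Local Notation F := (draw_filtration draw).

Lemma draw_filtration_sigma n : sigma_algebra setT (F n).
Proof. exact: smallest_sigma_algebra. Qed.

Lemma draw_filtration_measurable n : F n `<=` measurable.
Proof.
apply: smallest_sub; first exact: sigma_algebra_measurable.
by move=> A [k _] [i _] [B mB <-]; exact: mdraw.
Qed.

Lemma draw_filtration_le n1 n2 : (n1 <= n2)%N -> F n1 `<=` F n2.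
Proof.
move=> n12; apply: sub_sigma_algebra2 => A [k kn1 iA]; exists k => //=.
exact: leq_trans n12.
Qed.

Lemma draw_filtrationI n A B : F n A -> F n B -> F n (A `&` B).
Proof.
have /sigma_algebraP : forall X, F n X -> X `<=` setT by [].
by move=> /iffLR/(_ (draw_filtration_sigma n))[_ _ _]; exact.
Qed.

Lemma draw_filtration_bigcap n (I : choiceType) (D : set I) (A : I -> set T) :
  finite_set D -> (forall i, D i -> F n (A i)) -> F n (\bigcap_(i in D) A i).
Proof.
move=> finD FA; have [->|/set0P[i Di]] := eqVneq D set0.
  rewrite bigcap_set0 -[X in F n X]setD0.
  by have [F0 FC _] := draw_filtration_sigma n; exact: FC.
have := @draw_filtrationI n => /finN0_bigcap_closedP; apply => //.
by exists i.
Qed.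

(** [draw n] belongs to time step [n + 1], hence the shifted index of the filtration. *)
Lemma draw_filtration_pattern n S : F n.+1 (pattern n @^-1` [set S]).
Proof.
have -> : pattern n @^-1` [set S] =
    \bigcap_(i in [set: 'I_m]) (draw n i @^-1` [set i \in S]).
  apply/seteqP; split => w /=.
    by move=> <- i _ /=; rewrite inE.
  by move=> Sw; apply/setP => i; rewrite inE; exact: Sw.
apply: draw_filtration_bigcap => [|i _]; first exact: finite_finset.
apply: sub_sigma_algebra; exists n => //=; exists i => //.
by exists [set i \in S] => //; rewrite setTI.
Qed.

Lemma draw_filtration_bigcup n (A : nat -> set T) :
  (forall i, F n (A i)) -> F n (\bigcup_i A i).
Proof. by have [_ _] := draw_filtration_sigma n; exact. Qed.

Lemma draw_filtration0 n : F n set0.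
Proof. by have [] := draw_filtration_sigma n. Qed.

Lemma draw_filtration_bigcup_fin n (I : countType) (D : set I) (A : I -> set T) :
  (forall i, D i -> F n (A i)) -> F n (\bigcup_(i in D) A i).
Proof.
move=> FA.
have -> : \bigcup_(i in D) A i =
    \bigcup_k (if unpickle k is Some i then
                 if `[< D i >] then A i else set0 else set0).
  apply/seteqP; split => w.
    by move=> [i Di Aiw]; exists (pickle i) => //; rewrite pickleK asboolT.
  move=> [k _]; case: unpickle => // i; case: asboolP => // Di Aiw.
  by exists i.
apply: draw_filtration_bigcup => k; case: unpickle => [i|]; last first.
  exact: draw_filtration0.
by case: asboolP => [/FA//|_]; exact: draw_filtration0.
Qed.

Lemma draw_filtration_nwhite n B : F n (nwhite n @^-1` B).
Proof.
elim: n B => [|n IHn] B.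
  have [B_0|B_0] := pselect (B 0%N).
    rewrite (_ : _ @^-1` _ = setT); last first.
      by apply/seteqP; split => // w _ /=; rewrite /nwhite big_ord0.
    have [F0 FC _] := draw_filtration_sigma 0.
    by rewrite -[X in F 0 X]setD0; exact: FC.
  rewrite (_ : _ @^-1` _ = set0); first exact: draw_filtration0.
  by apply/seteqP; split => // w /=; rewrite /nwhite big_ord0.
have -> : nwhite n.+1 @^-1` B = \bigcup_(S in [set: {set 'I_m}])
   (pattern n @^-1` [set S] `&` nwhite n @^-1` [set i | B (i + #|S|)%N]).
  apply/seteqP; split => w /=.
    by rewrite nwhiteS => Bw; exists (pattern n w).
  by move=> [S _ [<-]] /=; rewrite nwhiteS.
apply: draw_filtration_bigcup_fin => S _; apply: draw_filtrationI.
  exact: draw_filtration_pattern.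
by apply: (@draw_filtration_le n) => //; exact: IHn.
Qed.

Lemma measurable_nwhite n B : measurable (nwhite n @^-1` B).
Proof. exact: @draw_filtration_measurable n _ (@draw_filtration_nwhite n B). Qed.

Lemma measurable_pattern n S : measurable (pattern n @^-1` [set S]).
Proof. exact: @draw_filtration_measurable n.+1 _ (@draw_filtration_pattern n S). Qed.

(** As [N_n <= n m], the cast to an ordinal loses nothing and makes [N_n] finitely valued, so that
    its integrals are finite sums. *)
Lemma inord_nwhiteE n (i : 'I_(n * m).+1) :
  (fun w => inord (nwhite n w)) @^-1` [set i] = nwhite n @^-1` [set i : nat].
Proof.
apply/seteqP; split => w /=.
  by move=> <-; rewrite inordK// ltnS nwhite_le.
by move=> wi; apply: val_inj; rewrite /= wi inordK.
Qed.

Lemma nwhiteEinord n w : nwhite n w = (inord (nwhite n w) : 'I_(n * m).+1).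
Proof. by rewrite inordK// ltnS nwhite_le. Qed.

Lemma integrable_nwhite n (g : nat -> R) A : measurable A ->
  P.-integrable A (fun w => (g (nwhite n w))%:E).
Proof.
move=> mA; under [X in integrable _ _ X]funext do rewrite nwhiteEinord.
apply: (@integrable_finitely_valued _ _ _ P _
  (fun w => inord (nwhite n w) : 'I_(n * m).+1) _ (fun i => g i)) => // i.
by rewrite inord_nwhiteE; exact: measurable_nwhite.
Qed.

Lemma integral_nwhite n (g : nat -> R) A : measurable A ->
  (\int[P]_(w in A) (g (nwhite n w))%:E =
   (\sum_(i < (n * m).+1) g i * Pr P (A `&` nwhite n @^-1` [set i : nat]))%:E)%E.
Proof.
move=> mA; under eq_integral do rewrite nwhiteEinord.
rewrite (@integral_finitely_valued _ _ _ P _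
  (fun w => inord (nwhite n w) : 'I_(n * m).+1) _ (fun i => g i))//; last first.
  by move=> i; rewrite inord_nwhiteE; exact: measurable_nwhite.
by under eq_bigr do rewrite inord_nwhiteE.
Qed.

Hypothesis law : drawn_with_replacement P c W0 B0 draw.

(** The event [N_n = i] lies in [F n], and on it the conditional probability of a pattern is a
    constant, which comes out of the integral. *)
Lemma Pr_next_pattern n i S A : F n A ->
  Pr P (A `&` nwhite n @^-1` [set i] `&` pattern n @^-1` [set S]) =
  frac n i ^+ #|S| * (1 - frac n i) ^+ (m - #|S|) *
  Pr P (A `&` nwhite n @^-1` [set i]).
Proof.
move=> FA; set A' := A `&` _.
have FA' : F n A' by apply: draw_filtrationI => //; exact: draw_filtration_nwhite.
have mA' : measurable A' by exact: (@draw_filtration_measurable n).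
have [_ _ _ /(_ _ FA')] := law n (fun i => i \in S).
rewrite (_ : [set w | _] = pattern n @^-1` [set S]); last first.
  apply/seteqP; split => w /=.
    by move=> Sw; apply/setP => j; rewrite inE; exact: Sw.
  by move=> <- j; rewrite inE.
rewrite integral_indic_Pr//; last exact: measurable_pattern.
rewrite (eq_integral (fun=> (frac n i ^+ #|S| * (1 - frac n i) ^+ (m - #|S|))%:E)).
  by rewrite integral_cst_Pr// => -[].
move=> w /set_mem[_ /= wi]; rewrite white_fractionE black_fractionE wi.
rewrite (bigID (fun j => j \in S))/=; congr (_ * _)%:E.
  by under eq_bigr => j -> do []; rewrite prodr_const.
under eq_bigr => j /negbTE -> do [].
rewrite prodr_const; congr (_ ^+ _).
have -> : (m - #|S|)%N = #|(~: S)%SET| by have := cardsC S; rewrite card_ord; lia.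
by apply: eq_card => j; rewrite !inE.
Qed.

(** The binomial law with parameters [m] and [x]. *)
Definition binom_kernel (x : R) k : R := x ^+ k * (1 - x) ^+ (m - k) *+ 'C(m, k).

Lemma sum_pattern (f : nat -> R) :
  \sum_(S : {set 'I_m}) f #|S| = \sum_(k < m.+1) f k *+ 'C(m, k).
Proof.
have cardm (S : {set 'I_m}) : (#|S| < m.+1)%N.
  by rewrite ltnS -[leqRHS]card_ord max_card.
rewrite (partition_big (fun S : {set 'I_m} => Ordinal (cardm S)) xpredT)//=.
apply: eq_bigr => k _.
rewrite (eq_bigr (fun=> f k)); last by move=> S /eqP <-.
rewrite sumr_const; congr (_ *+ _).
have := card_draws 'I_m k; rewrite card_ord => <-; apply: eq_card => S.
by rewrite !inE.
Qed.

(** The Markov property in integrated form. Both sides are split over the values of [N_n], the left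
    one also over the pattern drawn next; patterns are then grouped by cardinality. Different
    choices of [h] give the martingale property, the second moments and the point probabilities. *)
Lemma integral_next n (h : nat -> nat -> R) A : F n A ->
  (\int[P]_(w in A) (h (nwhite n w) #|pattern n w|)%:E =
   \int[P]_(w in A)
     (\sum_(k < m.+1) binom_kernel (frac n (nwhite n w)) k * h (nwhite n w) k)%:E)%E.
Proof.
move=> FA; have mA : measurable A by exact: (@draw_filtration_measurable n).
rewrite (integral_nwhite n
  (fun i => \sum_(k < m.+1) binom_kernel (frac n i) k * h i k))//.
pose Z w := (inord (nwhite n w) : 'I_(n * m).+1, pattern n w).
have ZE p : Z @^-1` [set p] =
    nwhite n @^-1` [set p.1 : nat] `&` pattern n @^-1` [set p.2].
  case: p => i S /=; rewrite -inord_nwhiteE.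
  by apply/seteqP; split => w /=; [case=> <- <-|move=> [<- <-]].
under eq_integral do rewrite nwhiteEinord.
rewrite (@integral_finitely_valued _ _ _ P _ Z _ (fun p => h p.1 #|p.2|))//; last first.
  move=> p; rewrite ZE; apply: measurableI; first exact: measurable_nwhite.
  exact: measurable_pattern.
congr EFin; transitivity (\sum_(i < (n * m).+1) \sum_(S : {set 'I_m})
    h i #|S| * Pr P (A `&` Z @^-1` [set (i, S)])).
  by rewrite pair_bigA; apply: eq_bigr => -[].
apply: eq_bigr => i _; rewrite mulr_suml.
under eq_bigr do rewrite ZE/= setIA Pr_next_pattern// mulrA.
rewrite (sum_pattern (fun k => h i k * (frac n i ^+ k * (1 - frac n i) ^+ (m - k)) *
  Pr P (A `&` nwhite n @^-1` [set i : nat]))).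
apply: eq_bigr => k _.
by rewrite /binom_kernel !mulrnAl [h i k * _]mulrC.
Qed.

End urn_process.

(** * The martingale *)

Section kernel_moments.
Context {R : realType}.

Lemma sum_binom_kernel m (x : R) : \sum_(k < m.+1) binom_kernel m x k = 1.
Proof.
rewrite -[RHS](expr1n R m) -[X in X ^+ m](subrK x 1) exprDn.
by apply: eq_bigr => k _; rewrite /binom_kernel mulrC.
Qed.

Lemma sum_binom_kernel_mean m (x : R) :
  \sum_(k < m.+1) binom_kernel m x k * k%:R = m%:R * x.
Proof.
case: m => [|m]; first by rewrite big_ord1 mulr0 mul0r.
rewrite big_ord_recl/= mulr0 add0r.
have <- : m.+1%:R * x * (\sum_(k < m.+1) binom_kernel m x k) = m.+1%:R * x.
  by rewrite sum_binom_kernel mulr1.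
rewrite mulr_sumr; apply: eq_bigr => k _.
rewrite /binom_kernel /bump/= add1n subSS mulr_natr -mulrnA [('C(_, _) * _)%N]mulnC.
rewrite -mul_bin_diag mulrnA mulrnAC exprS -!mulrA mulr_natl; congr (_ *+ _).
by rewrite mulrnAr.
Qed.

Lemma binom_kernel_ge0 m (x : R) k : 0 <= x <= 1 -> 0 <= binom_kernel m x k.
Proof.
by move=> /andP[x0 x1]; rewrite mulrn_wge0// mulr_ge0// exprn_ge0// subr_ge0.
Qed.

End kernel_moments.

Section urn_martingale.
Context d (T : measurableType d) (R : realType) (P : probability T R).
Context (m c W0 B0 : nat) (draw : nat -> 'I_m -> T -> bool).
Hypotheses (W0_gt0 : (0 < W0)%N)
  (mdraw : forall n i, measurable_fun setT (draw n i))
  (law : drawn_with_replacement P c W0 B0 draw).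
Local Notation F := (draw_filtration draw).
Local Notation N := (nwhite draw).
Local Notation frac := (frac R m c W0 B0).
Local Notation urn_size := (urn_size R m c W0 B0).
Local Notation X := (fun n w => frac n (N n w)).

(** Because [T_{n+1} = T_n + m c], the increment is a multiple of the deviation of [k] from its
    conditional mean [m x]. This yields both the martingale property and the step bound. *)
Lemma frac_nextB n i k : frac n.+1 (i + k) - frac n i =
  c%:R * (k%:R - m%:R * frac n i) / urn_size n.+1.
Proof.
have T0 : urn_size n != 0 by rewrite gt_eqF ?urn_size_gt0.
have T1 : urn_size n.+1 != 0 by rewrite gt_eqF ?urn_size_gt0.
have TS : urn_size n.+1 = urn_size n + m%:R * c%:R.
  by rewrite /urn_size mulSn mulnDl addnA addnAC natrD natrM.
rewrite /frac mulnDr addnA natrD (natrM _ c k).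
set w := (W0 + c * i)%:R.
apply: (mulIf T1); rewrite mulrBl !divfK// {1}TS.
by move: (urn_size n) T0 => t t0; field.
Qed.

Lemma frac_next_dist n i k : (0 < m)%N -> (0 < c)%N -> (k <= m)%N -> (i <= n * m)%N ->
  `|frac n.+1 (i + k) - frac n i| <= n.+1%:R^-1.
Proof.
move=> m0 c0 km inm; rewrite frac_nextB.
have T1 : 0 < urn_size n.+1 by rewrite urn_size_gt0.
rewrite normrM normfV (gtr0_norm T1) ler_pdivrMr// normrM ger0_norm//.
have x0 : 0 <= frac n i by exact: frac_ge0.
have x1 : frac n i <= 1 by exact: frac_le1.
have k0 : 0 <= k%:R :> R by [].
have km' : k%:R <= m%:R :> R by rewrite ler_nat.
have mx : m%:R * frac n i <= m%:R by rewrite ler_piMr.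
have mx0 : 0 <= m%:R * frac n i by rewrite mulr_ge0.
apply: (@le_trans _ _ (c%:R * m%:R)).
  by rewrite ler_wpM2l// ler_norml; apply/andP; split; lra.
(* The step is at most [c m / T_{n+1}], and [T_{n+1} >= (n + 1) m c]. *)
rewrite ler_pdivlMl ?ltr0n// /urn_size -!natrM ler_nat.
by rewrite [(c * m)%N]mulnC mulnA leq_addl.
Qed.

Lemma kernel_frac_mean n i :
  \sum_(k < m.+1) binom_kernel m (frac n i) k * (frac n.+1 (i + k) - frac n i) = 0.
Proof.
under eq_bigr => k _.
  rewrite frac_nextB mulrA mulrCA -mulrA mulrA mulrBr.
  over.
rewrite -mulr_suml -mulr_sumr sumrB sum_binom_kernel_mean -mulr_suml.
by rewrite sum_binom_kernel mul1r subrr mulr0 mul0r.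
Qed.

Lemma draw_filtration_is_filtration : is_filtration F.
Proof.
split => [n|n|n].
- exact: draw_filtration_sigma.
- exact: draw_filtration_measurable.
- exact: draw_filtration_le.
Qed.

Lemma frac_cond_expectation n : is_cond_expectation P (F n) (X n.+1) (X n).
Proof.
split.
- exact: integrable_nwhite.
- exact: integrable_nwhite.
- by move=> A [B _ <-]; rewrite setTI; exact: (@draw_filtration_nwhite _ _ _ draw n (frac n @^-1` B)).
move=> A FA; apply/esym.
under eq_integral do rewrite nwhiteS.
rewrite (integral_next W0_gt0 mdraw law (fun i k => frac n.+1 (i + k)))//.
apply: eq_integral => w _; congr EFin.
apply/eqP; rewrite -subr_eq0; apply/eqP.
rewrite -[X in _ - X]mul1r -(sum_binom_kernel m (frac n (N n w))) mulr_suml -sumrB.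
rewrite -[RHS](kernel_frac_mean n (N n w)).
by apply: eq_bigr => k _; rewrite mulrBr.
Qed.

Lemma frac_is_martingale : is_martingale P F X.
Proof.
split.
- exact: draw_filtration_is_filtration.
- by move=> n; have [] := frac_cond_expectation n.
- by move=> n; have [] := frac_cond_expectation n.
- exact: frac_cond_expectation.
Qed.

Hypotheses (m_gt0 : (0 < m)%N) (c_gt0 : (0 < c)%N).

(** Orthogonality of martingale increments: the cross term has mean 0 and the squared step is at
    most [1 / (n + 1)^2]. *)
Lemma kernel_frac_sqr n i x : (i <= n * m)%N ->
  \sum_(k < m.+1) binom_kernel m (frac n i) k * (frac n.+1 (i + k) - x) ^+ 2
  <= (frac n i - x) ^+ 2 + n.+1%:R ^- 2.
Proof.
move=> inm; set y := frac n i.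
have y01 : 0 <= y <= 1 by rewrite frac_ge0 frac_le1.
(* Adding the cross term, whose sum is 0, makes the inequality hold term by term. *)
have -> : (y - x) ^+ 2 + n.+1%:R ^- 2 =
    \sum_(k < m.+1) (binom_kernel m y k * ((y - x) ^+ 2 + n.+1%:R ^- 2) +
      binom_kernel m y k * (frac n.+1 (i + k) - y) * (2 * (y - x))).
  by rewrite big_split/= -!mulr_suml sum_binom_kernel kernel_frac_mean mul1r mul0r addr0.
apply: ler_sum => k _.
rewrite -mulrA -mulrDr ler_wpM2l ?binom_kernel_ge0//.
have : (frac n.+1 (i + k) - y) ^+ 2 <= n.+1%:R ^- 2.
  rewrite -exprVn -ler_sqrt ?exprn_ge0// ?invr_ge0//.
  rewrite !sqrtr_sqr [leRHS]ger0_norm ?invr_ge0//.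
  by rewrite frac_next_dist// -ltnS.
set z := frac n.+1 _; set e := _ ^- 2.
by move=> ze; lra.
Qed.

End urn_martingale.

(** * A deterministic convergence criterion *)

Section cubic_subsequence.
Context {R : realType}.

Lemma sum_inv_sqr_le n : \sum_(k < n) k.+1%:R ^- 2 <= 2 :> R.
Proof.
case: n => [|n]; first by rewrite big_ord0.
(* The subtracted [1 / (n + 1)] makes the bound inductive. *)
suff : \sum_(k < n.+1) k.+1%:R ^- 2 <= 2 - n.+1%:R^-1 :> R.
  by move=> /le_trans; apply; rewrite gerBl invr_ge0.
elim: n => [|n IHn]; first by rewrite big_ord1 expr1n invr1; lra.
rewrite big_ord_recr/= (le_trans (lerD IHn (lexx _)))//.
rewrite -[n.+2]addn1 natrD; set x := n.+1%:R.
have x0 : 0 < x by rewrite ltr0n.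
have x1 : 0 < x + 1 by rewrite addr_gt0.
have H : (x + 1) ^- 2 + (x + 1)^-1 <= x^-1.
  rewrite -subr_ge0 (_ : _ - _ = (x * (x + 1) ^+ 2)^-1).
    by rewrite invr_ge0 ltW// mulr_gt0// exprn_gt0.
  by field; rewrite !gt_eqF.
by move: ((x + 1) ^- 2) ((x + 1)^-1) (x^-1) H => p q r H; lra.
Qed.

Lemma is_cvg_series_inv_sqr : cvgn (series (fun k => k.+1%:R ^- 2 : R)).
Proof.
apply: nondecreasing_is_cvgn.
  by apply: nondecreasing_series => k _ _; rewrite invr_ge0 exprn_ge0.
by exists 2 => _ [n _ <-]; rewrite seriesEord; exact: sum_inv_sqr_le.
Qed.

(** Consecutive cubes are about [3 k^2] apart, a relative gap of order [1 / k]; 12 is a convenient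
    constant. *)
Lemma cube_gap k : ((k.+1 ^ 3 - k ^ 3) * k.+1 <= 12 * (k ^ 3).+1)%N.
Proof. by rewrite !expnS !expn0; nia. Qed.

Lemma sum_inv_sqr_cube_gap k :
  \sum_(k ^ 3 <= j < k.+1 ^ 3) j.+1%:R ^- 2 <= 48 / k.+1%:R ^+ 4 :> R.
Proof.
apply: (@le_trans _ _ (\sum_(k ^ 3 <= j < k.+1 ^ 3) (k ^ 3).+1%:R ^- 2)).
  rewrite big_nat [leRHS]big_nat; apply: ler_sum => j /andP[kj _].
  by rewrite lef_pV2 ?posrE ?exprn_gt0// lerXn2r ?nnegrE// ler_nat.
rewrite sumr_const_nat -[leLHS]mulr_natl ler_pdivrMr ?exprn_gt0//.
rewrite mulrAC ler_pdivlMr ?exprn_gt0// -!natrX -!natrM ler_nat.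
(* The constant 48 is this 4 times the 12 of [cube_gap]. *)
have H : (k.+1 ^ 3 <= 4 * (k ^ 3).+1)%N by case: (k) => [//|j]; rewrite !expnS !expn0; nia.
by have := leq_mul (cube_gap k) H; rewrite !expnS !expn0; lia.
Qed.

Lemma cube_bracket n : exists k, (k ^ 3 <= n < k.+1 ^ 3)%N.
Proof.
elim: n => [|n [k /andP[kn nk]]]; first by exists 0%N.
have [nk1|nk1] := ltnP n.+1 (k.+1 ^ 3).
  by exists k; rewrite nk1 (leq_trans kn).
exists k.+1; rewrite nk1/=.
by rewrite (leq_ltn_trans nk)// ltn_exp2r.
Qed.

(** The inequality between geometric and arithmetic means for [y |x|] and [1 / y]. With [y = k + 1]
    it turns weighted square summability into absolute summability. *)
Lemma norm_le_weighted_sqr (x y : R) : 0 < y -> `|x| <= y ^+ 2 * x ^+ 2 + y ^- 2.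
Proof.
move=> y0; have -> : `|x| = y * `|x| * y^-1 by rewrite mulrAC divff ?gt_eqF// mul1r.
rewrite -[x ^+ 2]real_normK ?num_real// -exprMn -exprVn.
by move: (y * `|x|) (y^-1) => p q; nra.
Qed.

Variable u : R^nat.
Hypothesis du : forall n, `|u n.+1 - u n| <= n.+1%:R^-1.

Lemma slow_dist a n : (a <= n)%N -> `|u n - u a| <= (n - a)%:R / a.+1%:R.
Proof.
elim: n => [|n IHn]; first by rewrite leqn0 => /eqP ->; rewrite subrr normr0 subnn mul0r.
rewrite leq_eqVlt => /predU1P[->|]; first by rewrite subrr normr0 subnn mul0r.
rewrite ltnS => an; rewrite subSn// -[X in _ <= X%:R / _]addn1 natrD mulrDl mul1r.
rewrite -[u n.+1](subrK (u n)) -addrA addrC (le_trans (ler_normD _ _))//.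
rewrite lerD ?IHn// (le_trans (du n))// lef_pV2 ?posrE ?ltr0n// ler_nat.
by rewrite ltnS.
Qed.

Lemma slow_cube_dist k n : (k ^ 3 <= n < k.+1 ^ 3)%N ->
  `|u n - u (k ^ 3)%N| <= 12 / k.+1%:R.
Proof.
move=> /andP[kn nk]; rewrite (le_trans (slow_dist kn))//.
rewrite ler_pdivrMr ?ltr0n// mulrAC ler_pdivlMr ?ltr0n// -!natrM ler_nat.
by rewrite (leq_trans _ (cube_gap k))// leq_mul2r leq_sub2r ?orbT// ltnW.
Qed.

(* Between two consecutive cubes [u] moves by [O(1 / k)] whatever happens, and
   along the cubes its increments are summable. *)
Lemma slow_cvg : cvgn (series (fun k => k.+1%:R ^+ 2 *
    (u (k.+1 ^ 3)%N - u (k ^ 3)%N) ^+ 2)) -> cvgn u.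
Proof.
move=> cs; pose v k := u (k ^ 3)%N.
have cv : cvgn v.
  have : cvgn [normed series (telescope v)].
    apply: (@series_le_cvg _ _ (fun k => k.+1%:R ^+ 2 *
      (u (k.+1 ^ 3)%N - u (k ^ 3)%N) ^+ 2 + k.+1%:R ^- 2)).
    - by move=> k; exact: normr_ge0.
    - move=> k; apply: addr_ge0; last by rewrite invr_ge0 exprn_ge0.
      by apply: mulr_ge0; exact: sqr_ge0.
    - by move=> k; apply: norm_le_weighted_sqr; rewrite ltr0n.
    - have -> : series (fun k => k.+1%:R ^+ 2 *
        (u (k.+1 ^ 3)%N - u (k ^ 3)%N) ^+ 2 + k.+1%:R ^- 2) =
         series (fun k => k.+1%:R ^+ 2 * (u (k.+1 ^ 3)%N - u (k ^ 3)%N) ^+ 2) +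
         series (fun k => k.+1%:R ^- 2) :> R^nat.
        by apply/funext => n; rewrite seriesD.
      by apply: is_cvgD => //; exact: is_cvg_series_inv_sqr.
  (* The telescoped series is [v n - v 0], so its limit has to be shifted by [a], which is [v 0]. *)
  move=> /normed_cvg; rewrite telescopeK => /cvg_ex[l /= vl].
  move: (v 0%N) vl => a vl; apply/cvg_ex; exists (l + a).
  rewrite (_ : v = (fun n => (v n - a) + a)); last first.
    by apply/funext => n; rewrite subrK.
  by apply: cvgD; [exact: vl|exact: cvg_cst].
apply/cvg_ex; exists (limn v); apply/cvgrPdist_le => e e0.
move/cvgrPdist_le : cv => /(_ (e / 2))[|K _ vK]; first by rewrite divr_gt0.
(* From [24 / e] on, the distance [12 / (k + 1)] to the preceding cube is at most [e / 2]. *)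
pose L := maxn K (Num.truncn (24 / e)).+1.
exists (L ^ 3)%N => // n /= Ln.
have [k /andP[kn nk]] := cube_bracket n.
have Lk : (L <= k)%N.
  by rewrite -ltnS -(@ltn_exp2r _ _ 3)// (leq_ltn_trans Ln).
rewrite -[limn v](subrK (v k)) -addrA (le_trans (ler_normD _ _))//.
rewrite [leRHS](splitr e) lerD//.
  by apply: vK => /=; rewrite (leq_trans _ Lk)// leq_maxl.
rewrite distrC (le_trans (@slow_cube_dist k n _)) ?kn//.
rewrite ler_pdivrMr ?ltr0n// mulrAC ler_pdivlMr// -natrM -ler_pdivrMl//.
rewrite mulrC (le_trans (ltW (truncnS_gt _)))// ler_nat ltnS.
by rewrite (leq_trans _ Lk)// (leq_trans _ (leq_maxr _ _)).
Qed.

End cubic_subsequence.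

(** * Almost sure convergence *)

Section urn_convergence.
Context d (T : measurableType d) (R : realType) (P : probability T R).
Context (m c W0 B0 : nat) (draw : nat -> 'I_m -> T -> bool).
Hypotheses (W0_gt0 : (0 < W0)%N)
  (mdraw : forall n i, measurable_fun setT (draw n i))
  (law : drawn_with_replacement P c W0 B0 draw)
  (m_gt0 : (0 < m)%N) (c_gt0 : (0 < c)%N).
Local Notation F := (draw_filtration draw).
Local Notation N := (nwhite draw).
Local Notation frac := (frac R m c W0 B0).
Local Notation X := (fun n w => frac n (N n w)).

Lemma measurable_frac_nwhite n : measurable_fun setT (X n).
Proof.
by move=> _ B _; rewrite setTI; exact: (measurable_nwhite mdraw n (frac n @^-1` B)).
Qed.

Lemma integral_sqr_next n A x : F n A ->
  (\int[P]_(w in A) ((X n.+1 w - x) ^+ 2)%:E <=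
   \int[P]_(w in A) ((X n w - x) ^+ 2)%:E + (n.+1%:R ^- 2 * Pr P A)%:E)%E.
Proof.
move=> FA; have mA : measurable A by exact: (@draw_filtration_measurable _ _ _ draw mdraw n).
under eq_integral do rewrite nwhiteS.
rewrite (integral_next W0_gt0 mdraw law (fun i k => (frac n.+1 (i + k) - x) ^+ 2))//.
rewrite (integral_nwhite P mdraw n
  (fun i => \sum_(k < m.+1) binom_kernel m (frac n i) k * (frac n.+1 (i + k) - x) ^+ 2))//.
rewrite (integral_nwhite P mdraw n (fun i => (frac n i - x) ^+ 2))//.
rewrite -integral_cst_Pr// (integral_nwhite P mdraw n (fun=> n.+1%:R ^- 2))//.
rewrite -EFinD lee_fin -big_split/=; apply: ler_sum => i _.
rewrite -mulrDl ler_wpM2r ?Pr_ge0//.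
by apply: kernel_frac_sqr => //; rewrite -ltnS.
Qed.

Lemma integral_sqr_le a n A x : (a <= n)%N -> F a A ->
  (\int[P]_(w in A) ((X n w - x) ^+ 2)%:E <=
   \int[P]_(w in A) ((X a w - x) ^+ 2)%:E +
     ((\sum_(a <= j < n) j.+1%:R ^- 2) * Pr P A)%:E)%E.
Proof.
move=> + FA; elim: n => [|n IHn].
  by rewrite leqn0 => /eqP ->; rewrite big_geq// mul0r adde0.
rewrite leq_eqVlt => /predU1P[<-|]; first by rewrite big_geq// mul0r adde0.
rewrite ltnS => an; rewrite big_nat_recr//= mulrDl EFinD addeA.
apply: (le_trans (integral_sqr_next x _)); last by rewrite leeD2r// IHn.
exact: (@draw_filtration_le _ _ _ draw a n an A FA).
Qed.

(** On each event [N_a = i] the variable [X_a] is a constant, so [integral_sqr_le] applies with that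
    constant as centre and its initial term vanishes. *)
Lemma integral_increment_sqr a n : (a <= n)%N ->
  (\int[P]_w ((X n w - X a w) ^+ 2)%:E <=
   (\sum_(a <= j < n) j.+1%:R ^- 2)%:E)%E.
Proof.
move=> an; pose A (i : 'I_(a * m).+1) := N a @^-1` [set i : nat].
have mA i : measurable (A i) by exact: measurable_nwhite.
have setTE : setT = \big[setU/set0]_(i <- enum 'I_(a * m).+1) A i.
  rewrite -bigcup_seq; apply/seteqP; split => // w _.
  exists (inord (N a w)); first by rewrite /= mem_enum.
  by rewrite /A /= inordK// ltnS nwhite_le.
have tA : trivIset [set` enum 'I_(a * m).+1] A.
  by move=> i j _ _ [w [/= wi wj]]; apply: val_inj; rewrite /= -wi -wj.
have mX n' : measurable_fun setT (X n') := measurable_frac_nwhite n'.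
rewrite setTE ge0_integral_bigsetU ?enum_uniq//; first last.
- by move=> w _; rewrite lee_fin sqr_ge0.
- rewrite -setTE; apply/measurable_EFinP.
  by apply: measurable_funX; apply: measurable_funB; exact: mX.
apply: (@le_trans _ _ (\sum_(i <- enum 'I_(a * m).+1)
    ((\sum_(a <= j < n) j.+1%:R ^- 2) * Pr P (A i))%:E)).
  apply: lee_sum => i _.
  rewrite (eq_integral (fun w => ((X n w - frac a i) ^+ 2)%:E)); last first.
    by move=> w /set_mem /= <-.
  have FA : F a (A i) by exact: draw_filtration_nwhite.
  apply: (le_trans (integral_sqr_le (frac a i) an FA)).
  rewrite (eq_integral (fun=> 0%:E)); last first.
    by move=> w /set_mem /= <-; rewrite subrr expr0n.
  by rewrite integral_cst_Pr// mul0r add0e.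
rewrite sumEFin lee_fin -mulr_sumr ler_piMr//.
  by apply: sumr_ge0 => j _; rewrite invr_ge0 exprn_ge0.
have := integral_nwhite P mdraw a (fun=> 1) (@measurableT _ T).
rewrite integral_cst_Pr// mul1r => -[].
under eq_bigr do rewrite mul1r setTI.
by rewrite big_enum/= => <-; exact: Pr_le1.
Qed.

Lemma frac_dist n w : `|X n.+1 w - X n w| <= n.+1%:R^-1.
Proof.
rewrite /= nwhiteS frac_next_dist// ?nwhite_le//.
by rewrite -[leqRHS]card_ord max_card.
Qed.

Lemma ae_cvg_frac : {ae P, forall w, cvgn (X ^~ w)}.
Proof.
(* The weight [(k + 1)^2] against a mean square of order [(k + 1)^-4] leaves a summable expectation,
   of total at most [48 * 2]; hence the random series is almost surely finite. *)
pose f k w := k.+1%:R ^+ 2 * (X (k.+1 ^ 3)%N w - X (k ^ 3)%N w) ^+ 2.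
have mf k : measurable_fun setT (f k).
  apply: measurable_funM => //; apply: measurable_funX.
  by apply: measurable_funB; exact: measurable_frac_nwhite.
have f0 k w : 0 <= f k w by rewrite mulr_ge0 ?sqr_ge0// exprn_ge0.
have intf k : (\int[P]_w (f k w)%:E <= (48 * k.+1%:R ^- 2)%:E)%E.
  under eq_integral do rewrite EFinM.
  rewrite ge0_integralZl//; last 2 first.
  - apply/measurable_EFinP; apply: measurable_funX.
    by apply: measurable_funB; exact: measurable_frac_nwhite.
  - by move=> w _; rewrite lee_fin sqr_ge0.
  have kk : (k ^ 3 <= k.+1 ^ 3)%N by rewrite leq_exp2r.
  apply: (le_trans (lee_pmul _ _ (lexx _) (integral_increment_sqr kk))).
  - by rewrite lee_fin exprn_ge0.
  - by apply: integral_ge0 => w _; rewrite lee_fin sqr_ge0.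
  rewrite -EFinM lee_fin.
  rewrite (le_trans (ler_wpM2l _ (sum_inv_sqr_cube_gap k))) ?exprn_ge0//.
  have : k.+1%:R != 0 :> R by rewrite pnatr_eq0.
  by move: k.+1%:R => y y0; rewrite le_eqVlt; apply/orP; left; apply/eqP; field.
have fin : (\int[P]_w (\sum_(0 <= k <oo) (f k w)%:E) < +oo)%E.
  rewrite integral_nneseries//; last 2 first.
  - by move=> k; apply/measurable_EFinP.
  - by move=> k w _; rewrite lee_fin.
  apply: (@le_lt_trans _ _ 96%:E); last exact: ltry.
  apply: lime_le.
    by apply: is_cvg_nneseries => k _ _; apply: integral_ge0 => w _; rewrite lee_fin.
  near=> n; apply: (@le_trans _ _ (\sum_(0 <= k < n) (48 * k.+1%:R ^- 2)%:E)%E).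
    by apply: lee_sum => k _; exact: intf.
  rewrite sumEFin lee_fin -mulr_sumr big_mkord.
  by rewrite (_ : 96 = 48 * 2) ?ler_pM2l ?sum_inv_sqr_le//; ring.
have mS : measurable_fun setT (fun w => (\sum_(0 <= k <oo) (f k w)%:E)%E).
  apply: ge0_emeasurable_sum => //.
  - by move=> k w _ _; rewrite lee_fin.
  - by move=> k _; apply/measurable_EFinP.
have intS : P.-integrable setT (fun w => (\sum_(0 <= k <oo) (f k w)%:E)%E).
  apply/integrableP; split => //.
  under eq_integral => w _.
    rewrite gee0_abs; last by apply: nneseries_ge0 => k _ _; rewrite lee_fin.
    over.
  exact: fin.
have := integrable_ae measurableT intS.
apply: filterS => w /(_ I) Sfin; apply: slow_cvg => [n|]; first exact: frac_dist.
apply: nondecreasing_is_cvgn.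
  by apply: nondecreasing_series => k _ _; exact: f0.
exists (fine (\sum_(0 <= k <oo) (f k w)%:E)%E) => _ [n _ <-].
rewrite -lee_fin fineK// seriesEnat/= -sumEFin.
by apply: nneseries_lim_ge => k _ _; rewrite lee_fin f0.
Unshelve. all: by end_near. Qed.

End urn_convergence.

(** * Point probabilities of the number of white draws *)

Lemma count_between (R : realFieldType) (a b : R) M : a <= b ->
  \sum_(i < M) (a < i%:R < b)%R%:R <= b - a + 1.
Proof.
move=> ab; suff [] : \sum_(i < M) (a < i%:R < b)%R%:R <= Num.max 0 (M%:R - a) /\
  \sum_(i < M) (a < i%:R < b)%R%:R <= b - a + 1 by [].
elim: M => [|M [IH1 IH2]]; first by rewrite big_ord0 le_max lexx; split => //; lra.
rewrite big_ord_recr/=; have [/andP[aM Mb]|_] := boolP (a < M%:R < b).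
  have S : \sum_(i < M) (a < i%:R < b)%R%:R <= M%:R - a.
    by rewrite (le_trans IH1)// ge_max lexx subr_ge0 ltW.
  rewrite -natr1; split; last by rewrite /=; lra.
  by rewrite le_max; apply/orP; right => /=; lra.
rewrite addr0; split => //; rewrite (le_trans IH1)// ge_max le_max lexx/=.
by rewrite le_max lerD2r ler_nat leqnSn orbT.
Qed.

Section urn_density.
Context d (T : measurableType d) (R : realType) (P : probability T R).
Context (m c W0 B0 : nat) (draw : nat -> 'I_m -> T -> bool).
Hypotheses (W0_gt0 : (0 < W0)%N) (B0_gt0 : (0 < B0)%N)
  (mdraw : forall n i, measurable_fun setT (draw n i))
  (law : drawn_with_replacement P c W0 B0 draw)
  (m_gt0 : (0 < m)%N) (c_gt0 : (0 < c)%N).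
Local Notation F := (draw_filtration draw).
Local Notation N := (nwhite draw).
Local Notation frac := (frac R m c W0 B0).
Local Notation urn_size := (urn_size R m c W0 B0).
Local Notation X := (fun n w => frac n (N n w)).

Lemma Pr_nwhite_next n j A : F n A ->
  Pr P (A `&` N n.+1 @^-1` [set j]) =
  \sum_(i < (n * m).+1) (\sum_(k < m.+1 | (i + k)%N == j) binom_kernel m (frac n i) k)
    * Pr P (A `&` N n @^-1` [set i : nat]).
Proof.
move=> FA; have mA : measurable A by exact: (@draw_filtration_measurable _ _ _ draw mdraw n).
suff : ((Pr P (A `&` N n.+1 @^-1` [set j]))%:E = (\sum_(i < (n * m).+1)
    (\sum_(k < m.+1 | (i + k)%N == j) binom_kernel m (frac n i) k)
    * Pr P (A `&` N n @^-1` [set i : nat]))%:E)%E by case.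
rewrite -integral_indic_Pr//; last exact: measurable_nwhite.
rewrite -(integral_nwhite P mdraw n
  (fun i => \sum_(k < m.+1 | (i + k)%N == j) binom_kernel m (frac n i) k))//.
rewrite (eq_integral
  (fun w => ((N n w + #|pattern draw n w|)%N == j)%:R%:E)); last first.
  move=> w _; rewrite -nwhiteS indicE; congr (nat_of_bool _)%:R%:E.
  by apply/idP/eqP => [/set_mem//|/= ?]; exact/mem_set.
rewrite (integral_next W0_gt0 mdraw law (fun i k => ((i + k)%N == j)%:R))//.
apply: eq_integral => w _; congr EFin; rewrite [RHS]big_mkcond.
by apply: eq_bigr => k _; case: ifP; rewrite ?mulr1 ?mulr0.
Qed.

Lemma nwhite_between l n w : (l <= n)%N -> (N l w <= N n w <= N l w + (n - l) * m)%N.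
Proof.
elim: n => [|n IHn]; first by rewrite leqn0 => /eqP ->; rewrite subnn mul0n addn0 leqnn.
rewrite leq_eqVlt => /predU1P[->|]; first by rewrite subnn mul0n addn0 leqnn.
rewrite ltnS => ln; have /andP[lo hi] := IHn ln; rewrite nwhiteS subSn// mulSn.
have pm : (#|pattern draw n w| <= m)%N by rewrite -[leqRHS]card_ord max_card.
by rewrite (leq_trans lo (leq_addr _ _))/= addnCA addnC leq_add.
Qed.

(** For [n > 0], [T_n >= n c] and [n + 1 <= 2 n]. *)
Lemma ratio_bound n : (0 < n)%N -> 0 <= c%:R / urn_size n <= 1 /\
  c%:R / urn_size n <= 2 / n.+1%:R.
Proof.
move=> n0; have T0 : 0 < urn_size n by rewrite urn_size_gt0.
have cT : (c * n.+1 <= 2 * (W0 + B0 + n * m * c))%N.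
  have : (n * c <= n * m * c)%N by rewrite leq_mul2r leq_pmulr// orbT.
  by nia.
have cT' : (c <= W0 + B0 + n * m * c)%N by nia.
split; first by rewrite divr_ge0 ?ler0n//= ler_pdivrMr// mul1r ler_nat.
by rewrite ler_pdivrMr// mulrAC ler_pdivlMr ?ltr0n// -!natrM ler_nat.
Qed.

Lemma frac_subn n j k : (k <= j)%N ->
  frac n (j - k) = frac n j - (c%:R / urn_size n) *+ k.
Proof.
move=> kj; have T0 : urn_size n != 0 by rewrite gt_eqF ?urn_size_gt0.
have ckj : (c * k <= c * j)%N by rewrite leq_mul2l kj orbT.
rewrite /frac -mulrnAl -mulrBl -mulrnA -natrB; last first.
  by rewrite (leq_trans ckj)// leq_addl.
by rewrite mulnBr addnBA.
Qed.

(** Every predecessor has mass at most [M], so only the total incoming weight matters, and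
    [abel_kernel_bound] controls it. The condition on [j] gives [d <= y <= 1 + (m - 1) d] for the
    proportion [y] attached to [j]. *)
Lemma Pr_nwhite_step : exists2 C : R, 0 <= C & forall n j A (M : R),
  F n A -> (0 < n)%N -> (0 < j < n.+1 * m)%N ->
  (forall i, Pr P (A `&` N n @^-1` [set i]) <= M) ->
  Pr P (A `&` N n.+1 @^-1` [set j]) <=
  M * (1 - (c%:R / urn_size n) *+ m + C * (c%:R / urn_size n) ^+ 2).
Proof.
have [C C0 kbound] := abel_kernel_bound (R := R) m.
exists C => // n j A M FA n0 /andP[j0 jnm] qM.
have M0 : 0 <= M by rewrite (le_trans (Pr_ge0 _ _) (qM 0%N)).
rewrite Pr_nwhite_next//.
have [/andP[d0 d1] _] := ratio_bound n0.
set dl := c%:R / urn_size n in d0 d1 *.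
have T0 : 0 < urn_size n by rewrite urn_size_gt0.
have frac01 (i : 'I_(n * m).+1) : 0 <= frac n i <= 1.
  by rewrite frac_ge0 frac_le1// -ltnS.
apply: (@le_trans _ _ (\sum_(i < (n * m).+1)
    (\sum_(k < m.+1 | (i + k)%N == j) binom_kernel m (frac n i) k) * M)).
  apply: ler_sum => i _; rewrite ler_wpM2l//.
  by apply: sumr_ge0 => k _; exact: binom_kernel_ge0.
rewrite -mulr_suml mulrC ler_wpM2l//.
rewrite (exchange_big_dep xpredT)//=.
have := kbound dl (frac n j); rewrite d0 d1 => /(_ isT) bound.
apply: (le_trans _ (bound _ _)); last 2 first.
- rewrite /dl /frac ler_pM2r ?invr_gt0// ler_nat.
  by rewrite (leq_trans _ (leq_addl _ _))// leq_pmulr.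
- rewrite -subr_ge0 /dl /frac.
  rewrite (_ : _ - _ = (urn_size n + (c * m)%:R - c%:R - (W0 + c * j)%:R) / urn_size n).
    rewrite divr_ge0 ?(ltW T0)// -addrA -opprD subr_ge0 /urn_size -!natrD ler_nat.
    have : (c * j.+1 <= c * (n.+1 * m))%N by rewrite leq_mul2l jnm orbT.
    by rewrite mulSn; lia.
  rewrite -mulrnAl -mulr_natr -natrM.
  by move: (urn_size n) T0 => t t0; field; rewrite gt_eqF.
(* For given [k] the only predecessor is [j - k]. If [N_n] cannot take this value, the left side is
   0 and the right side is still nonnegative. *)
rewrite [leRHS]big_mkcond; apply: ler_sum => k _ /=.
have [/andP[kj jk]|out] := boolP ((k <= j) && (j - k < (n * m).+1))%N.
  rewrite (big_pred1 (Ordinal jk)); last first.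
    by move=> i /=; rewrite -val_eqE /=; apply/eqP/eqP => [|->]; lia.
  rewrite /= -frac_subn//.
  by have := frac01 (Ordinal jk) => /= ->.
rewrite big_pred0 => [|i].
  case: ifP => // y01; exact: (@binom_kernel_ge0 R m (frac n j - dl *+ k) k).
apply: contraNF out => /eqP <-.
by rewrite leq_addl addnK ltn_ord.
Qed.

Definition both_drawn l := N l @^-1` [set i | (0 < i < l * m)%N].

Lemma draw_filtration_both_drawn l n : (l <= n)%N -> F n (both_drawn l).
Proof.
move=> ln; apply: (@draw_filtration_le _ _ _ draw l n ln).
exact: draw_filtration_nwhite.
Qed.

Lemma measurable_both_drawn l : measurable (both_drawn l).
Proof. exact: measurable_nwhite. Qed.

(** Once both colours have been drawn, [N_n] stays off its two extreme values, as [Pr_nwhite_step]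
    requires of its target. *)
Lemma both_drawn_nwhite l n j : (l <= n)%N ->
  both_drawn l `&` N n @^-1` [set j] !=set0 -> (0 < j < n * m)%N.
Proof.
move=> ln [w [/= /andP[lo hi] <-]].
have /andP[lo' hi'] := nwhite_between w ln.
rewrite (leq_trans lo lo')/= (leq_ltn_trans hi')//.
by rewrite -[X in (_ < X * _)%N](subnKC ln) mulnDl ltn_add2r.
Qed.

(* Along one step the total size grows by the factor [1 + m d], [d = c / T_n],
   which compensates the factor [1 - m d + O(d ^ 2)] gained by the maximum of
   the point probabilities. *)
Lemma Pr_nwhite_bound l : (0 < l)%N -> exists2 K : R, 0 <= K &
  forall n j, (l <= n)%N ->
    Pr P (both_drawn l `&` N n @^-1` [set j]) <= K / urn_size n.
Proof.
move=> l0; have [C C0 step] := Pr_nwhite_step.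
(* [(1 - m d + C d^2) (1 + m d) <= 1 + C (1 + m) d^2] for [d <= 1], and the 4 comes from
   [d <= 2 / (n + 1)]. The factors accumulate through [1 + x <= exp x]. *)
pose C' := 4 * (C * (1 + m%:R)).
pose B n := urn_size l * expR (C' * \sum_(i < n) i.+1%:R ^- 2).
have T0 n : 0 < urn_size n by rewrite urn_size_gt0.
have C'0 : 0 <= C' by rewrite !mulr_ge0// addr_ge0.
have sum0 n : 0 <= \sum_(i < n) i.+1%:R ^- 2 :> R.
  by apply: sumr_ge0 => i _; rewrite invr_ge0 exprn_ge0.
exists (urn_size l * expR (C' * 2)); first by rewrite mulr_ge0 ?expR_ge0// ltW.
suff H n j : (l <= n)%N ->
    Pr P (both_drawn l `&` N n @^-1` [set j]) <= B n / urn_size n.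
  move=> n j ln; rewrite (le_trans (H n j ln))// ler_pM2r ?invr_gt0//.
  by rewrite ler_pM2l// ler_expR ler_wpM2l// sum_inv_sqr_le.
have U0 k : 0 <= B k / urn_size k.
  by rewrite divr_ge0 ?(ltW (T0 _))// mulr_ge0 ?expR_ge0// ltW.
elim: n j => [|n IHn] j; first by rewrite leqNgt l0.
rewrite leq_eqVlt => /predU1P[<-|].
  rewrite /B mulrAC divff ?gt_eqF// mul1r.
  apply: (@le_trans _ _ 1).
    apply: Pr_le1; apply: measurableI; last exact: measurable_nwhite.
    exact: measurable_both_drawn.
  by rewrite -[leLHS]expR0 ler_expR mulr_ge0.
rewrite ltnS => ln; have n0 := leq_trans l0 ln.
have [->|/set0P ne] := eqVneq (both_drawn l `&` N n.+1 @^-1` [set j]) set0.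
  by rewrite /Pr measure0; exact: U0.
have jb := both_drawn_nwhite (leqW ln) ne.
apply: (le_trans (step n j _ _ (draw_filtration_both_drawn ln) n0 jb (fun i => IHn i ln))).
have [/andP[d0 d1] d2] := ratio_bound n0.
have TS : urn_size n.+1 = urn_size n * (1 + m%:R * (c%:R / urn_size n)).
  rewrite mulrDr mulr1 [X in _ + X]mulrC -mulrA divfK ?gt_eqF// /urn_size mulSn mulnDl.
  by rewrite addnA addnAC natrD natrM.
rewrite ler_pdivlMr// {1}TS.
have -> : B n.+1 = B n * expR (C' * n.+1%:R ^- 2).
  by rewrite /B big_ord_recr/= mulrDr expRD mulrA.
set dl := c%:R / urn_size n in d0 d1 d2 *.
have Bn0 : 0 <= B n by rewrite mulr_ge0 ?expR_ge0// ltW.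
have -> : B n / urn_size n * (1 - dl *+ m + C * dl ^+ 2) * (urn_size n * (1 + m%:R * dl)) =
    B n * ((1 - dl *+ m + C * dl ^+ 2) * (1 + m%:R * dl)).
  rewrite mulrACA divfK ?gt_eqF// mulrA.
rewrite ler_wpM2l//; apply: le_trans (expR_ge1Dx _).
have d4 : dl ^+ 2 <= 4 * n.+1%:R ^- 2.
  rewrite (_ : 4 * _ = (2 / n.+1%:R) ^+ 2).
    by rewrite lerXn2r// nnegrE// divr_ge0.
  by rewrite expr_div_n; congr (_ / _); ring.
have m0 : 0 <= m%:R :> R by [].
have C4 : C * (1 + m%:R) * dl ^+ 2 <= C' * n.+1%:R ^- 2.
  by rewrite /C' [4 * _]mulrC -[leRHS]mulrA ler_wpM2l// mulr_ge0// addr_ge0.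
rewrite -mulr_natl (le_trans _ (lerD (lexx 1) C4))//.
rewrite -subr_ge0 (_ : _ - _ = (m%:R * dl) ^+ 2 + C * m%:R * dl ^+ 2 * (1 - dl)).
  by rewrite addr_ge0 ?sqr_ge0// mulr_ge0 ?subr_ge0// mulr_ge0 ?sqr_ge0// mulr_ge0.
by ring.
Qed.

(** The values of [X_n] are spaced by [c / T_n], so at most [(b - a) T_n / c + 1] of them lie in the
    interval, each of mass at most [K / T_n]. *)
Lemma Pr_frac_between l : (0 < l)%N -> exists2 K : R, 0 <= K &
  forall n a b, (l <= n)%N -> a <= b ->
    Pr P (both_drawn l `&` X n @^-1` `]a, b[) <= K * (b - a) + K / n.+1%:R.
Proof.
move=> l0; have [K K0 HK] := Pr_nwhite_bound l0.
exists K => // n a b ln ab.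
have T0 : 0 < urn_size n by rewrite urn_size_gt0.
have c0 : 0 < c%:R :> R by rewrite ltr0n.
pose f (i : nat) : R := (a < frac n i < b)%R%:R.
have mE := measurable_both_drawn l.
suff H : Pr P (both_drawn l `&` X n @^-1` `]a, b[) =
    \sum_(i < (n * m).+1) f i * Pr P (both_drawn l `&` N n @^-1` [set i : nat]).
  rewrite H; apply: (@le_trans _ _ (\sum_(i < (n * m).+1) f i * (K / urn_size n))).
    by apply: ler_sum => i _; rewrite ler_wpM2l// HK.
  rewrite -mulr_suml.
  pose a' := (a * urn_size n - W0%:R) / c%:R; pose b' := (b * urn_size n - W0%:R) / c%:R.
  have ab' : a' <= b' by rewrite ler_pM2r ?invr_gt0// lerD2r ler_pM2r.
  have fE (i : 'I_(n * m).+1) : f i = (a' < i%:R < b')%R%:R.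
    rewrite /f /frac /a' /b' ltr_pdivlMr// ltr_pdivrMr//.
    rewrite ltr_pdivrMr// ltr_pdivlMr//.
    by rewrite natrD natrM ltrBlDl ltrBrDl [i%:R * _]mulrC.
  under eq_bigr do rewrite fE.
  apply: (le_trans (ler_wpM2r _ (count_between _ ab'))).
    by rewrite divr_ge0// ltW.
  have -> : b' - a' = (b - a) * urn_size n / c%:R by rewrite /a' /b'; field; rewrite gt_eqF.
  rewrite mulrDl mul1r lerD//.
    rewrite [leLHS](_ : _ = K * ((b - a) / c%:R)); last first.
      by move: (urn_size n) T0 (c%:R : R) c0 => t t0 r r0; field; rewrite !gt_eqF.
    by rewrite ler_wpM2l// ler_pdivrMr// ler_peMr ?subr_ge0// ler1n.
  rewrite ler_wpM2l// lef_pV2 ?posrE// ler_nat.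
  have : (n <= n * m * c)%N by rewrite -mulnA leq_pmulr// muln_gt0 m_gt0.
  by move: W0_gt0; lia.
have mX : measurable (X n @^-1` `]a, b[).
  exact: (measurable_nwhite mdraw n (frac n @^-1` `]a, b[%classic)).
suff : ((Pr P (both_drawn l `&` X n @^-1` `]a, b[))%:E = (\sum_(i < (n * m).+1)
    f i * Pr P (both_drawn l `&` N n @^-1` [set i : nat]))%:E)%E by case.
rewrite -integral_indic_Pr// -(integral_nwhite P mdraw n f)//.
apply: eq_integral => w _; rewrite indicE /f; congr (nat_of_bool _)%:R%:E.
by apply/idP/idP => [/set_mem|?]; [|apply/mem_set]; rewrite /= in_itv.
Qed.

(** * Probability that a colour stays undrawn *)

Lemma sum_inv_unbounded (D M : R) : 0 < D ->
  exists n0, forall n, (n0 <= n)%N -> M <= \sum_(i < n) (D * i.+1%:R)^-1.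
Proof.
move=> D0; apply: contrapT => /forallNP bounded.
apply: (@dvg_harmonic R); apply: nondecreasing_is_cvgn.
  by apply: nondecreasing_series => k _ _; exact: harmonic_ge0.
exists (D * M) => _ [n0 _ <-].
have /existsNP[n /not_implyP[n0n /negP]] := bounded n0.
rewrite -ltNge => /ltW lt_M.
have le_n : series harmonic n0 <= series harmonic n :> R.
  by apply: nondecreasing_series n0n => k _ _; exact: harmonic_ge0.
rewrite (le_trans le_n)// -ler_pdivrMl// (le_trans _ lt_M)// seriesEord/=.
rewrite mulr_sumr; apply: ler_sum => i _.
by rewrite /harmonic invfM.
Qed.

Lemma urn_size_le n : urn_size n <= (W0 + B0 + m * c)%:R * n.+1%:R.
Proof.
rewrite /urn_size -natrM ler_nat mulnS -[(n * m * c)%N]mulnA [(n * (m * c))%N]mulnC.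
have : (m * c * n <= (W0 + B0 + m * c) * n)%N by rewrite leq_mul2r leq_addl orbT.
by lia.
Qed.

(* [u n] is the probability that a given colour is never drawn in the first [n]
   steps, [t] the number of its balls in the initial urn. *)
Lemma avoiding_vanishes (t : nat) (u : nat -> R) : (0 < t)%N ->
  (forall n, 0 <= u n) -> u 0%N <= 1 ->
  (forall n, u n.+1 <= (1 - t%:R / urn_size n) * u n) ->
  forall e, 0 < e -> exists n0, forall n, (n0 <= n)%N -> u n <= e.
Proof.
move=> t0 u0 u1 step e e0.
pose D : R := (W0 + B0 + m * c)%:R.
have D0 : 0 < D by rewrite ltr0n -!addnA addn_gt0 W0_gt0.
(* As [t >= 1] and [T_n <= D (n + 1)], each step costs a factor [exp (- 1 / (D (n + 1)))]; the
   harmonic series diverges. *)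
have H n : u n <= expR (- \sum_(i < n) (D * i.+1%:R)^-1).
  elim: n => [|n IHn]; first by rewrite big_ord0 oppr0 expR0.
  rewrite big_ord_recr/= opprD expRD mulrC (le_trans (step n))//.
  have q : 1 - t%:R / urn_size n <= expR (- (D * n.+1%:R)^-1).
    rewrite (le_trans _ (expR_ge1Dx _))// lerD2l lerN2.
    apply: (@le_trans _ _ (urn_size n)^-1).
      rewrite lef_pV2 ?posrE; first exact: urn_size_le.
        by rewrite mulr_gt0.
      exact: urn_size_gt0.
    by rewrite ler_peMl ?ler1n// invr_ge0 ltW// urn_size_gt0.
  rewrite (le_trans (ler_wpM2r (u0 n) q))// ler_wpM2l ?expR_ge0//.
have [n0 Hn0] := sum_inv_unbounded (- ln e) D0.
exists n0 => n nn0; rewrite (le_trans (H n))// -[leRHS]lnK ?posrE// ler_expR.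
by rewrite lerNl Hn0.
Qed.

Lemma draw_filtrationT n : F n setT.
Proof.
by have [F0 FC _] := draw_filtration_sigma draw n; rewrite -[setT]setD0; exact: FC.
Qed.

Lemma exprn_le_self (x : R) : 0 <= x <= 1 -> x ^+ m <= x.
Proof. by move=> /andP[x0 x1]; rewrite -[leRHS]expr1 ler_wiXn2l. Qed.

(** While no white ball is drawn the proportion is [x = W0 / T_n], and [(1 - x)^m <= 1 - x] gives
    the recursion of [avoiding_vanishes]. *)
Lemma Pr_no_white_vanishes e : 0 < e ->
  exists n0, forall n, (n0 <= n)%N -> Pr P (N n @^-1` [set 0%N]) <= e.
Proof.
apply: (avoiding_vanishes W0_gt0) => [n| |n].
- exact: Pr_ge0.
- by apply: Pr_le1; exact: measurable_nwhite.
have := Pr_nwhite_next 0 (@draw_filtrationT n); rewrite !setTI => ->.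
rewrite big_ord_recl/= [X in _ + X]big1 ?addr0; last first.
  by move=> i _; rewrite big_pred0 ?mul0r.
rewrite setTI ler_wpM2r ?Pr_ge0// (big_pred1 ord0)//.
rewrite /binom_kernel expr0 mul1r subn0 bin0 /frac muln0 addn0.
have x0 := frac_ge0 R m c W0 B0 n 0; have := frac_le1 R c B0 W0_gt0 (leq0n (n * m)).
rewrite /frac muln0 addn0 in x0 * => x1.
by apply: exprn_le_self; rewrite subr_ge0 x1 gerBl.
Qed.

Lemma Pr_no_black_vanishes e : 0 < e ->
  exists n0, forall n, (n0 <= n)%N -> Pr P (N n @^-1` [set (n * m)%N]) <= e.
Proof.
apply: (avoiding_vanishes B0_gt0) => [n| |n].
- exact: Pr_ge0.
- by apply: Pr_le1; exact: measurable_nwhite.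
have := Pr_nwhite_next (n.+1 * m) (@draw_filtrationT n); rewrite !setTI => ->.
rewrite big_ord_recr/= [X in X + _]big1 ?add0r; last first.
  move=> i _; rewrite big_pred0 ?mul0r// => k; apply/negbTE.
  by have := ltn_ord i; have := ltn_ord k; rewrite mulSn; lia.
rewrite setTI ler_wpM2r ?Pr_ge0// (big_pred1 ord_max); last first.
  by move=> k /=; rewrite -val_eqE/= mulSn addnC eqn_add2r.
rewrite /binom_kernel/= subnn expr0 mulr1 binn mulr1n.
have -> : 1 - B0%:R / urn_size n = frac n (n * m).
  have T0 : urn_size n != 0 by rewrite gt_eqF ?urn_size_gt0.
  apply/eqP; rewrite subr_eq /frac -mulrDl -natrD; apply/eqP.
  rewrite -[LHS](divff T0); congr (_ / _); rewrite /urn_size [(c * _)%N]mulnC.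
  by rewrite addnAC.
by apply: exprn_le_self; rewrite frac_ge0 frac_le1.
Qed.

Lemma both_drawn_almost_sure e : 0 < e -> exists2 l, (0 < l)%N &
  Pr P (~` both_drawn l) <= e.
Proof.
move=> e0; have e20 : 0 < e / 2 by rewrite divr_gt0.
have [n1 H1] := Pr_no_white_vanishes e20.
have [n2 H2] := Pr_no_black_vanishes e20.
pose l := (maxn n1 n2).+1; exists l => //.
have n1l : (n1 <= l)%N by rewrite leqW// leq_maxl.
have n2l : (n2 <= l)%N by rewrite leqW// leq_maxr.
have mN j : measurable (N l @^-1` [set j]) by exact: measurable_nwhite.
apply: (@le_trans _ _ (Pr P (N l @^-1` [set 0%N] `|` N l @^-1` [set (l * m)%N]))).
  apply: Pr_le.
  - by apply: measurableC; exact: measurable_both_drawn.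
  - exact: measurableU.
  - move=> w /= /negP; rewrite negb_and -leqNgt leqn0 -leqNgt => /orP[/eqP ->|lm].
      by left.
    by right; apply/eqP; rewrite eqn_leq lm nwhite_le.
by rewrite (le_trans (PrU_le _ _ _))// [leRHS]splitr lerD ?H1 ?H2.
Qed.

End urn_density.

(** * Passage to the limit *)

Section limits_of_probabilities.
Context d (T : measurableType d) (R : realType) (P : probability T R).

(** Fatou's lemma for events, by continuity of the measure along the increasing intersections. *)
Lemma Pr_liminf_le (G : (set T)^nat) r : (forall n, measurable (G n)) ->
  (forall e, 0 < e -> exists n0, forall n, (n0 <= n)%N -> Pr P (G n) <= r + e) ->
  Pr P (\bigcup_k \bigcap_(n in [set n | (k <= n)%N]) G n) <= r.
Proof.
move=> mG Gr; pose H k := \bigcap_(n in [set n | (k <= n)%N]) G n.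
have mH k : measurable (H k) by apply: bigcap_measurable => //; exists k => /=.
have mU : measurable (\bigcup_k H k) by exact: bigcupT_measurable.
have ndH : {homo H : n m / (n <= m)%N >-> (n <= m)%O}.
  move=> k1 k2 k12; apply/subsetPset => w Hw n /= k2n; apply: Hw.
  exact: leq_trans k2n.
have Hr k : Pr P (H k) <= r.
  apply/ler_addgt0Pr => e /Gr[n0 Gn0].
  rewrite (le_trans _ (Gn0 (maxn n0 k) _)) ?leq_maxl//.
  by apply: Pr_le => // w; apply => /=; exact: leq_maxr.
rewrite -lee_fin EFin_Pr//.
have cH := @nondecreasing_cvg_mu _ _ _ P H mH mU ndH.
rewrite -(cvg_lim _ cH)//; apply: lime_le; first by apply/cvg_ex; eexists; exact: cH.
by near=> k; rewrite /= -EFin_Pr// lee_fin.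
Unshelve. all: by end_near. Qed.

(** The interval is open: if the limit lies in it, then so do all late [X n]. Outside a null set the
    event is thus contained in a lower limit of events. *)
Lemma Pr_limit_interval_le (E : set T) (X : nat -> T -> R) (Y : T -> R) (K a b : R) :
  measurable E -> (forall n, measurable_fun setT (X n)) -> measurable_fun setT Y ->
  {ae P, forall w, X n w @[n --> \oo] --> Y w} ->
  (forall e, 0 < e -> exists n0, forall n, (n0 <= n)%N ->
    Pr P (E `&` X n @^-1` `]a, b[) <= K + e) ->
  Pr P (E `&` Y @^-1` `]a, b[) <= K.
Proof.
move=> mE mX mY [Z [mZ Z0 XY]] XK.
have mG n : measurable (E `&` X n @^-1` `]a, b[).
  by apply: measurableI => //; rewrite -[X in measurable X]setTI; exact: mX.
have mEY : measurable (E `&` Y @^-1` `]a, b[).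
  by apply: measurableI => //; rewrite -[X in measurable X]setTI; exact: mY.
set L := \bigcup_k \bigcap_(n in [set n | (k <= n)%N]) (E `&` X n @^-1` `]a, b[).
have mL : measurable L.
  by apply: bigcupT_measurable => k; apply: bigcap_measurable => //; exists k => /=.
have PZ : Pr P Z = 0 by rewrite /Pr Z0.
apply: (@le_trans _ _ (Pr P (L `|` Z))).
  apply: Pr_le => //; first exact: measurableU.
  move=> w [Ew Yw]; have [Zw|nZw] := pselect (Z w); [by right|left].
  have Xw : X n w @[n --> \oo] --> Y w by apply: contrapT => h; apply: nZw; exact: XY.
  have : nbhs (Y w) `]a, b[%classic by apply: open_nbhs_nbhs; split => //; exact: interval_open.
  by move=> /Xw[k _ kX]; exists k => // n /= kn; split => //; exact: kX.
by rewrite (le_trans (PrU_le _ _ _))// PZ addr0; exact: Pr_liminf_le.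
Qed.

Lemma null_of_interval_le (E : set T) (Y : T -> R) (K : R) : 0 <= K ->
  measurable E -> measurable_fun setT Y ->
  (forall a b, a <= b -> Pr P (E `&` Y @^-1` `]a, b[) <= K * (b - a)) ->
  forall B : set R, measurable B -> lebesgue_measure B = 0 ->
  Pr P (E `&` Y @^-1` B) = 0.
Proof.
move=> K0 mE mY YK B mB B0.
have mEY D : measurable D -> measurable (E `&` Y @^-1` D).
  by move=> mD; apply: measurableI => //; rewrite -[X in measurable X]setTI; exact: mY.
(* Lebesgue covers consist of half-open intervals; each is enclosed in a slightly longer open
   one. *)
have YKoc a b : a <= b -> Pr P (E `&` Y @^-1` `]a, b]) <= K * (b - a).
  move=> ab; apply/ler_addgt0Pr => e e0.
  pose e' := e / (K + 1).
  have K1 : 0 < K + 1 by rewrite ltr_wpDl.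
  have e'0 : 0 < e' by rewrite divr_gt0.
  have be : b <= b + e' by rewrite lerDl ltW.
  apply: (@le_trans _ _ (Pr P (E `&` Y @^-1` `]a, b + e'[))).
    apply: Pr_le; [exact: mEY|exact: mEY|move=> w [Ew Yw]; split => //].
    move: Yw => /=; rewrite !in_itv/= => /andP[-> wb] /=.
    by rewrite (le_lt_trans wb)// ltrDl.
  rewrite (le_trans (YK _ _ (le_trans ab be)))// addrAC mulrDr lerD2l.
  by rewrite /e' mulrCA ler_piMr ?(ltW e0)// ler_pdivrMr// mul1r lerDl.
apply/eqP; rewrite eq_le Pr_ge0 andbT; apply/ler_addgt0Pr => e e0; rewrite add0r.
have K1 : 0 < K + 1 by rewrite ltr_wpDl.
(* Lebesgue measure is the outer measure of interval length, so [B] has covers of total length below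
   [e / (K + 1)]; the [+ 1] keeps the quotient meaningful for [K = 0]. *)
have : (mu_ext (wlength idfun) B < (e / (K + 1))%:E)%E.
  rewrite [X in (X < _)%E](_ : _ = lebesgue_measure B)// B0 lte_fin.
  by rewrite divr_gt0.
move=> /ereal_inf_lt[_ [A [mA BA] <-] Ae].
rewrite -lee_fin EFin_Pr; last exact: mEY.
have mA' k : measurable (A k : set R) by exact: sub_sigma_algebra.
apply: (@le_trans _ _ (\sum_(0 <= k <oo) P (E `&` Y @^-1` A k))%E).
  apply: measure_sigma_subadditive.
  - by move=> k; exact: mEY.
  - exact: mEY.
  - by rewrite -setI_bigcupr -preimage_bigcup => w [Ew /BA].
apply: (@le_trans _ _ (\sum_(0 <= k <oo) (K%:E * wlength idfun (A k)))%E).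
  apply: lee_nneseries => [k _ _|k _]; first exact: measure_ge0.
  have [[a b] _ /= Ak] := mA k; rewrite -Ak.
  have [ab|ba] := leP a b.
    rewrite wlength_itv_bnd//= -EFinM -EFin_Pr ?lee_fin ?YKoc//.
    by apply: mEY; rewrite Ak.
  rewrite set_itv_ge ?bnd_simp -?leNgt ?(ltW ba)// preimage_set0 setI0 measure0 wlength0.
  by rewrite mule0.
rewrite nneseriesZl; last by move=> k _; exact: wlength_ge0.
apply: (@le_trans _ _ (K%:E * (e / (K + 1))%:E)%E).
  by rewrite lee_wpmul2l ?lee_fin// ltW.
by rewrite -EFinM lee_fin mulrCA ler_piMr ?(ltW e0)// ler_pdivrMr// mul1r lerDl.
Qed.

End limits_of_probabilities.

Theorem theorem3 (R : realType) (d : measure_display) (T : measurableType d)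
    (P : probability T R) (m c W0 B0 : nat)
    (draw : nat -> 'I_m -> {RV P >-> bool}) :
  (1 <= m)%N -> (1 <= c)%N -> (0 < W0)%N -> (0 < B0)%N -> (m <= W0 + B0)%N ->
  drawn_with_replacement P c W0 B0 draw ->
  [/\ is_martingale P (draw_filtration draw)
        (white_fraction R c W0 B0 draw),
      forall n w, 0 < white_fraction R c W0 B0 draw n w &
      exists Winf : {RV P >-> R},
        {ae P, forall w,
           white_fraction R c W0 B0 draw n w @[n --> \oo] --> Winf w} /\
        distribution P Winf `<< @lebesgue_measure R].
Proof.
move=> m0 c0 W0_gt0 B0_gt0 _ law.
have mdraw n i : measurable_fun setT (draw n i) by exact: measurable_funPT.
pose X n w := frac R m c W0 B0 n (nwhite draw n w).
have XE : white_fraction R c W0 B0 draw = X.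
  by apply/funext => n; apply/funext => w; exact: white_fractionE.
rewrite XE; split.
- exact: frac_is_martingale.
- move=> n w; rewrite divr_gt0 ?urn_size_gt0// ltr0n.
  by rewrite (leq_trans W0_gt0)// leq_addr.
have X01 n w : 0 <= X n w <= 1.
  by rewrite frac_ge0 frac_le1// nwhite_le.
have mX n : measurable_fun setT (X n) by exact: measurable_frac_nwhite.
(* The upper limit is measurable and defined everywhere; it is the limit wherever the sequence
   converges. *)
pose Y w := limn_sup (X ^~ w).
have mY : measurable_fun setT Y.
  apply: measurable_fun_limn_sup => // w _.
  - by exists 1 => _ [n _ <-]; have /andP[] := X01 n w.
  - by exists 0 => _ [n _ <-]; have /andP[] := X01 n w.
have XY : {ae P, forall w, X n w @[n --> \oo] --> Y w}.
  apply: filterS (ae_cvg_frac W0_gt0 mdraw law m0 c0) => w cX.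
  by rewrite /Y cvg_limn_supE.
have mYpre B : measurable B -> measurable (Y @^-1` B).
  by move=> mB; rewrite -[_ @^-1` _]setTI; exact: mY.
pose Winf : {RV P >-> R} := HB.pack Y (isMeasurableFun.Build _ _ _ _ Y mY).
exists Winf; split => // S null_S B mB BS; rewrite /distribution /pushforward.
have mYB : measurable (Y @^-1` B) by exact: mYpre.
suff : Pr P (Y @^-1` B) <= 0.
  move=> YB0; rewrite -[LHS]EFin_Pr//; congr EFin; apply/eqP.
  by rewrite eq_le YB0 Pr_ge0.
(* [K] depends on [l], but it only serves to give mass exactly 0 on [both_drawn draw l]; the
   complement has mass at most [e]. *)
apply/ler_addgt0Pr => e e0; rewrite add0r.
have [l l0 El] := both_drawn_almost_sure W0_gt0 B0_gt0 mdraw law m0 c0 e0.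
have mE := measurable_both_drawn mdraw l.
have [K K0 XK] := Pr_frac_between W0_gt0 B0_gt0 mdraw law m0 c0 l0.
have EB0 : Pr P (both_drawn draw l `&` Y @^-1` B) = 0.
  apply: (null_of_interval_le K0) => // [a b ab|]; last exact: null_S.
  apply: (Pr_limit_interval_le (X := X)) => // r r0.
  exists (maxn l (Num.truncn (K / r))) => n.
  rewrite geq_max => /andP[ln rn]; rewrite (le_trans (XK n a b ln ab))// lerD2l.
  rewrite ler_pdivrMr// mulrC -ler_pdivrMr// ltW// (lt_le_trans (truncnS_gt _))//.
  by rewrite ler_nat.
apply: le_trans El; rewrite -[leRHS]add0r -EB0.
apply: (@le_trans _ _ (Pr P ((both_drawn draw l `&` Y @^-1` B) `|` ~` both_drawn draw l))).
  apply: Pr_le => //.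
    by apply: measurableU; [exact: measurableI|exact: measurableC].
  by move=> w Yw; have [Ew|nEw] := pselect (both_drawn draw l w); [left|right].
by apply: PrU_le; [exact: measurableI|exact: measurableC].
Qed.
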